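(* Let $\left(K_{i(e)},w_e,p_e\right)_{e\in E}$ be a contractive Markov system satisfying the standing assumptions of the context, with an invariant Borel probability measure $\mu$. Let $M$ be the associated generalized Markov measure, $S$ the associated generalized Markov shift, $F$ the coding map, and $F(M)$ the image measure of $M$ under $F$. Let $h_M(S)$ be the Kolmogorov-Sinai entropy of $S$ with respect to $M$. Then: (i) If $\sum_{i=1}^N\int_{K_i}d(x,x_i)\,d\mu(x)<\infty$ for some $x_i\in K_i$, $i=1,\dots,N$, then \[h_M(S)=-\sum_{e\in E}\int_{K_{i(e)}} p_e\log p_e\,dF(M).\] (ii) If $\mu$ is the unique invariant Borel probability measure of the contractive Markov system, then \[h_M(S)=-\sum_{e\in E}\int_{K_{i(e)}} p_e\log p_e\,d\mu.\]
   Context: Markov system. Let $(V,E,i,t)$ be a finite directed (multi)graph, with vertex set $V=\{1,\dots,N\}$ ($N=1$ allowed), finite edge set $E$, and maps $i:E\to V$, $t:E\to V$ giving the initial and terminal vertex of each edge. Let $(K,d)$ be a metric space and $K_1,\dots,K_N$ a partition of $K$ into non-empty Borel subsets. Let $(w_e)_{e\in E}$ be Borel measurable maps $w_e:K\to K$ with $w_e(K_{i(e)})\subset K_{t(e)}$ for all $e\in E$. Let $(p_e)_{e\in E}$ be Borel measurable functions on $K$ with $p_e(x)\ge 0$ for all $e \in E$ and $\sum_{e\in E}p_e(x)=1$ for all $x\in K$, such that each $p_e$ is zero on the complement of $K_{i(e)}$. The family $\left(K_{i(e)},w_e,p_e\right)_{e\in E}$ is called a Markov system. It is a contractive Markov system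 (CMS) with average contracting rate $0<a<1$ iff \[\sum_{e\in E}p_e(x)\,d(w_ex,w_ey)\le a\,d(x,y)\quad\text{for all }x,y\in K_i,\ i=1,\dots,N.\] Invariant measure. For bounded Borel measurable $f$ on $K$ put $Uf:=\sum_{e\in E}p_e\cdot (f\circ w_e)$, and for a Borel probability measure $\nu$ on $K$ put $U^*\nu(f):=\int Uf\,d\nu$. A Borel probability measure $\mu$ is invariant iff $U^*\mu=\mu$. Dini-continuity. A real function $h$ on a metric space $(X,d)$ is Dini-continuous iff $\int_0^c\frac{\phi(t)}{t}dt<\infty$ for some $c>0$, where $\phi(t):=\sup\{|h(x)-h(y)|:d(x,y)\le t,\ x,y\in X\}$. Standing assumptions. $\left(K_{i(e)},w_e,p_e\right)_{e\in E}$ is a CMS with average contracting rate $0<a<1$ and an invariant Borel probability measure $\mu$. Sets of finite diameter in $(K,d)$ are relatively compact. $K_1,\dots,K_N$ partition $K$ into non-empty open subsets. Each $p_e|_{K_{i(e)}}$ is Dini-continuous. There is $\delta>0$ with $p_e|_{K_{i(e)}}\ge\delta$ for all $e\in E$. The map $i:E\to V$ is surjective. Generalized Markov shift. $\Sigma:=E^{\mathbb{Z}}=\{(\dots,\sigma_{-1},\sigma_0,\sigma_1,\dots):\sigma_j\in E\ \forall j\in\mathbb{Z}\}$ with the product topology (of the discrete topology on $E$) and Borel $\sigma$-algebra $\mathcal{B}(\Sigma)$. $S:\Sigma\to\Sigma$ is the left shift, $(S\sigma)_j=\sigma_{j+1}$. $M$ is the Borel probability measure on $\Sigma$ (the generalized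 Markov measure) given on thin cylinders ${}_m[e_1,\dots,e_k]:=\{\sigma\in\Sigma:\sigma_m=e_1,\dots,\sigma_{m+k-1}=e_k\}$, $m\in\mathbb{Z}$, by \[M\left({}_m[e_1,\dots,e_k]\right):=\int p_{e_1}(x)p_{e_2}(w_{e_1}x)\cdots p_{e_k}(w_{e_{k-1}}\circ\dots\circ w_{e_1}x)\,d\mu(x).\] $S$ preserves $M$. Coding map. Choosing $x_i\in K_i$ for $i=1,\dots,N$, the coding map $F:\Sigma\to K$ is \[F(\sigma):=\lim_{m\to-\infty}w_{\sigma_0}\circ w_{\sigma_{-1}}\circ\dots\circ w_{\sigma_m}x_{i(\sigma_m)}\quad\text{for }M\text{-a.e. }\sigma\in\Sigma.\] It is a known fact, taken as given, that this limit exists $M$-a.e. and does not depend, modulo an $M$-null set, on the choice of the $x_i$. $F(M)$ denotes the image (push-forward) measure of $M$ under $F$ on the Borel sets of $K$. Convention: $0\log 0=0$. *)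

(* Defs.v *)
From HB Require Import structures.
From mathcomp Require Import all_boot all_order all_algebra.
From mathcomp Require Import all_classical all_reals all_analysis.

Set Implicit Arguments.
Unset Strict Implicit.
Unset Printing Implicit Defensive.

Import Order.TTheory GRing.Theory Num.Theory.
Import numFieldNormedType.Exports.

Local Open Scope classical_set_scope.
Local Open Scope ring_scope.

(* The library's measurable types are pointed, hence these two joins. The point
   is never referred to; K and E are nonempty below, as K carries a probability
   measure. *)
#[short(type="pmetricType")]
HB.structure Definition PointedMetric (R : numDomainType) :=
  {K of Metric R K & Pointed K}.

#[short(type="pfinType")]
HB.structure Definition PointedFinite := {E of Finite E & Pointed E}.

Notation borel T := (g_sigma_algebraType (@open T)).

Section MarkovSystem.
Context {R : realType} {K : pmetricType R} {N : nat} {E : finType}.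

Record markovSystem := MarkovSystem {
  ini : E -> 'I_N ;
  ter : E -> 'I_N ;
  cell : 'I_N -> set K ;
  edge_map : E -> K -> K ;
  edge_prob : E -> K -> R ;
  cell_partition : partition [set: 'I_N] cell [set: K] ;
  cell_measurable : forall i, measurable (cell i : set (borel K)) ;
  edge_map_measurable :
    forall e, measurable_fun [set: borel K] (edge_map e : borel K -> borel K) ;
  edge_map_cell : forall e, edge_map e @` cell (ini e) `<=` cell (ter e) ;
  edge_prob_measurable :
    forall e, measurable_fun [set: borel K] (edge_prob e : borel K -> R) ;
  edge_prob_ge0 : forall e x, 0 <= edge_prob e x ;
  edge_prob_sum1 : forall x, \sum_(e : E) edge_prob e x = 1 ;
  edge_prob_out : forall e x, ~ cell (ini e) x -> edge_prob e x = 0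
}.

Implicit Types (Ms : markovSystem) (mu : probability (borel K) R).

Definition contractive Ms (a : R) :=
  forall i x y, cell Ms i x -> cell Ms i y ->
    \sum_(e : E) edge_prob Ms e x * mdist (edge_map Ms e x) (edge_map Ms e y)
      <= a * mdist x y.

Definition markov_op Ms (f : K -> R) (x : K) : R :=
  \sum_(e : E) edge_prob Ms e x * f (edge_map Ms e x).

Definition invariant_measure Ms mu :=
  forall f : K -> R, measurable_fun [set: borel K] (f : borel K -> R) ->
    (exists B : R, forall x, `|f x| <= B) ->
    (\int[mu]_x (markov_op Ms f x)%:E = \int[mu]_x (f x)%:E)%E.

Definition diam (A : set K) : \bar R :=
  ereal_sup [set r | exists x y, [/\ A x, A y & r = (mdist x y)%:E]].

Definition modulus (D : set K) (h : K -> R) (t : R) : \bar R :=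
  ereal_sup [set r | exists x y,
    [/\ D x, D y, mdist x y <= t & r = `|h x - h y|%:E]].

Definition dini_continuous (D : set K) (h : K -> R) :=
  exists2 c : R, 0 < c &
    (\int[lebesgue_measure]_(t in `]0%R, c[) (modulus D h t * (t^-1)%:E)
       < +oo)%E.

(* p_{e_1}(x) p_{e_2}(w_{e_1} x) ... p_{e_k}(w_{e_{k-1}} o ... o w_{e_1} x) *)
Fixpoint path_prob Ms (s : seq E) (x : K) : R :=
  if s is e :: s'
  then edge_prob Ms e x * path_prob Ms s' (edge_map Ms e x) else 1.

(* The term m = - n of the sequence defining the coding map:
   w_{s_0} o w_{s_{-1}} o ... o w_{s_{-n}} x_{i(s_{-n})}. *)
Definition coding_approx Ms (x : 'I_N -> K) (s : int -> E) (n : nat) : K :=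
  foldr (fun (j : nat) y => edge_map Ms (s (- j%:Z)) y)
        (x (ini Ms (s (- n%:Z)))) (iota 0 n.+1).

End MarkovSystem.
Arguments markovSystem {R} K N E.

Notation shift_space E :=
  (borel (prod_topology (fun _ : int => discrete_topology E))).

Section MarkovShift.
Context {R : realType} {K : pmetricType R} {N : nat} {E : pfinType}.

Definition left_shift (s : shift_space E) : shift_space E := fun j => s (j + 1).

Definition cylinder (m : int) (k : nat) (e : k.-tuple E) :
    set (shift_space E) :=
  [set s | forall j : 'I_k, s (m + j%:Z) = tnth e j].

Definition is_markov_measure (Ms : markovSystem K N E)
    (mu : probability (borel K) R) (M : probability (shift_space E) R) :=
  forall (m : int) (k : nat) (e : k.-tuple E),
    (M (cylinder m e) = \int[mu]_x (path_prob Ms e x)%:E)%E.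

(* The coding map is determined up to a null set only: F is any measurable
   version of the almost everywhere limit. *)
Definition is_coding_map (Ms : markovSystem K N E)
    (M : probability (shift_space E) R) (x : 'I_N -> K)
    (F : {mfun shift_space E >-> borel K}) :=
  {ae M, forall s, coding_approx Ms x s n @[n --> \oo] --> (F s : K)}.

End MarkovShift.

Section Entropy.
Context d {X : measurableType d} {R : realType}.
Variables (P : probability X R) (T : X -> X).

(* ln 0 = 0 in the library, in accordance with 0 log 0 = 0. *)
Definition set_entropy (I : finType) (A : I -> set X) : R :=
  - \sum_(i : I) fine (P (A i)) * ln (fine (P (A i))).

(* the join of A, T^-1 A, ..., T^-(n-1) A, its cells indexed by words of
   length n; cells may be empty *)
Definition iter_join (k : nat) (A : 'I_k -> set X) (n : nat)
    (f : {ffun 'I_n -> 'I_k}) : set X :=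
  [set x | forall j : 'I_n, A (f j) (iter j T x)].

Definition partition_entropy (k : nat) (A : 'I_k -> set X) : R :=
  limn (fun n => set_entropy (iter_join A (n := n.+1)) / n.+1%:R).

Definition KS_entropy : \bar R :=
  ereal_sup [set h | exists (k : nat) (A : 'I_k -> set X),
    [/\ partition [set: 'I_k] A [set: X], forall i, measurable (A i) &
        h = (partition_entropy A)%:E]].

End Entropy.

(* Main.v *)
Require Import Defs.
From HB Require Import structures.
From mathcomp Require Import all_boot all_order all_algebra.
From mathcomp Require Import all_classical all_reals all_analysis.
From mathcomp Require Import measurable_realfun ring lra zify.

Set Implicit Arguments.
Unset Strict Implicit.
Unset Printing Implicit Defensive.

Import Order.TTheory GRing.Theory Num.Theory.
Import numFieldNormedType.Exports.

Local Open Scope classical_set_scope.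
Local Open Scope ring_scope.

(** Both formulas say that the entropy of the shift is the integral over mu of
    - sum_e p_e log p_e, once two facts are known.

    The first is that F transports M to mu, at least when tested against a
    bounded function g that is uniformly continuous on each cell K_i
    (Rintegral_coding). Write w x for the image of x under the maps along a
    word w, p_w(x) for the probability of w from x, q(w) for its integral over
    mu, and x_w for the base point of the cell in which w starts. By invariance
    the integral of g is the integral of the sum over words w of length n of
    p_w(x) g(w x). Replacing g(w x) by g(w x_w) costs at most the discrepancy,
    the sum of the p_w(x) |g(w x) - g(w x_w)|. Contraction on average, iterated
    along words (word_map_contraction), makes this sum tend to 0 for every x,
    and dominated convergence makes its integral tend to 0. So the integral of
    g is the limit of the sums of q(w) g(w x_w) (cvg_sum_word_prob_base), and
    such a sum is the M-expectation of g at the n-th approximation of F.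

    The second is that the entropy H(n) of the law of n consecutive letters
    under M grows at the rate - sum_e int p_e log p_e dmu (block_entropy_rate).
    Indeed H(n+1) - H(n) is the average, with weights q(w), of the entropies of
    the laws q(w e) / q(w) of the next letter e given the last n letters w, and
    these laws are close on average to p_e(w x_w), again by the estimate on the
    discrepancy, now for g = p_e. As t log t is uniformly continuous on [0, 1],
    the increments have the same limit as minus the sum over w and e of q(w)
    (p_e log p_e)(w x_w), which the first fact identifies; H(n) / n follows by
    Cesaro means.

    It remains to prove that the Kolmogorov-Sinai entropy of a stationary
    measure on sequences over a finite alphabet is the rate of H(n) / n
    (shift_KS_entropy), that is, that the partition according to one letter is
    generating. A finite partition is compared with the one according to the
    letters in a window [-m, m]: a single application of the Gibbs inequality
    bounds the entropy of n steps of its itinerary by H(n + 2m + 1) plus n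
    times the entropy of the partition conditional on the window
    (joint_entropy_le, entropy_itinerary_le), and that conditional entropy is
    small for large m because every measurable set is approximated by sets that
    depend on finitely many letters (local_set_approximation). *)

(** * The function t log t *)

Section XlnX.
Context {R : realType}.
Implicit Types s t u v : R.

Definition xlnx t := t * ln t.

Lemma xlnx0 : xlnx 0 = 0. Proof. by rewrite /xlnx mul0r. Qed.

Lemma xlnx1 : xlnx 1 = 0. Proof. by rewrite /xlnx ln1 mulr0. Qed.

Lemma xlnx_le0 t : 0 <= t <= 1 -> xlnx t <= 0.
Proof. by case/andP=> t0 t1; rewrite /xlnx mulr_ge0_le0// ln_le0. Qed.

Lemma ln_sub_le u v : 0 < u -> 0 < v -> ln u - ln v <= (u - v) / v.
Proof.
move=> u0 v0; rewrite -ln_div//.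
have -> : u / v = 1 + (u - v) / v by field; rewrite gt_eqF.
apply: le_ln1Dx.
have -> : (u - v) / v = u / v - 1 by field; rewrite gt_eqF.
by rewrite ltrBrDl subrr divr_gt0.
Qed.

Lemma ln_dist_le c u v : 0 < c -> c <= u -> c <= v ->
  `|ln u - ln v| <= c^-1 * `|u - v|.
Proof.
move=> c0; wlog uv : u v / u <= v => [wl cu cv|cu cv].
  by case/orP: (le_total u v) => [/wl|/wl]; [exact|rewrite distrC (distrC u); exact].
have u0 := lt_le_trans c0 cu; have v0 := lt_le_trans c0 cv.
rewrite ler0_norm; last by rewrite subr_le0 ler_ln.
rewrite ler0_norm ?subr_le0// !opprB (le_trans (ln_sub_le v0 u0))// mulrC.
by rewrite ler_wpM2r ?subr_ge0// lef_pV2.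
Qed.

(** The form in which uniform continuity is used throughout: an additive error
    eps and a linear term, which survives averaging. To obtain it, ln is frozen
    below a small c: this moves t ln t by at most c and leaves a Lipschitz
    function. *)
Lemma xlnx_almost_lipschitz (eps : R) : 0 < eps -> exists2 C, 0 <= C &
  forall s t, 0 <= s <= 1 -> 0 <= t <= 1 ->
    `|xlnx s - xlnx t| <= eps + C * `|s - t|.
Proof.
move=> eps0; pose c := Num.min 1 (eps / 2).
have c0 : 0 < c by rewrite lt_min ltr01 divr_gt0.
have c1 : c <= 1 by rewrite ge_min lexx.
have ceps : c <= eps / 2 by rewrite ge_min lexx orbT.
pose h t := t * ln (Num.max t c).
have near_h t : 0 <= t <= 1 -> `|xlnx t - h t| <= eps / 2.
  case/andP=> t0 t1; rewrite /h; case: (leP c t) => ct.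
    by rewrite subrr normr0 divr_ge0// ltW.
  have [->|tn0] := eqVneq t 0; first by rewrite xlnx0 mul0r subr0 normr0 divr_ge0// ltW.
  have tp : 0 < t by rewrite lt_neqAle eq_sym tn0.
  rewrite /xlnx -mulrBr normrM (ger0_norm t0).
  rewrite ler0_norm ?subr_le0 ?ler_ln ?posrE ?(ltW ct)// opprB.
  apply: (@le_trans _ _ (c - t)); last by lra.
  have -> : c - t = t * ((c - t) / t) by field; rewrite gt_eqF.
  by rewrite ler_wpM2l// ln_sub_le.
have cmax t : c <= Num.max t c by rewrite le_max lexx orbT.
have h_lip s t : 0 <= s <= 1 -> 0 <= t <= 1 ->
    `|h s - h t| <= (`|ln c| + c^-1) * `|s - t|.
  move=> /andP[s0 s1] /andP[t0 t1].
  have -> : h s - h t = (s - t) * ln (Num.max s c) +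
     t * (ln (Num.max s c) - ln (Num.max t c)) by rewrite /h; ring.
  rewrite (le_trans (ler_normD _ _))// [leRHS]mulrDl lerD//.
    rewrite normrM mulrC ler_wpM2r//.
    rewrite ler0_norm ?ln_le0 ?ge_max ?s1// ler0_norm ?ln_le0// lerN2.
    by rewrite ler_ln// posrE (lt_le_trans c0).
  rewrite normrM (ger0_norm t0) -[leRHS]mul1r ler_pM//.
  rewrite (le_trans (ln_dist_le c0 (cmax _) (cmax _)))// ler_wpM2l ?invr_ge0 ?(ltW c0)//.
  have := ler_norm (s - t); have := ler_norm (t - s). rewrite distrC ler_norml.
  by case: (leP s c) => ?; case: (leP t c) => ? ? ?; apply/andP; split; lra.
exists (`|ln c| + c^-1); first by rewrite addr_ge0// invr_ge0 ltW.
move=> s t hs ht; have := h_lip _ _ hs ht.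
have := near_h _ hs; have := near_h _ ht.
rewrite !ler_norml => /andP[? ?] /andP[? ?] /andP[? ?].
by apply/andP; split; lra.
Qed.

(** From ln u <= u - 1 applied to u = q i / p i. *)
Lemma gibbs (T : finType) (p q : T -> R) :
  (forall i, 0 <= p i) -> (forall i, 0 <= q i) ->
  (forall i, q i = 0 -> p i = 0) -> \sum_i q i <= \sum_i p i ->
  - \sum_i xlnx (p i) <= - \sum_i p i * ln (q i).
Proof.
move=> p0 q0 qp0 sqp; rewrite lerN2 -subr_ge0 -sumrB.
have : \sum_i (p i - q i) <= \sum_i (xlnx (p i) - p i * ln (q i)).
  apply: ler_sum => i _; have [pi0|pin0] := eqVneq (p i) 0.
    by rewrite pi0 xlnx0 mul0r subrr sub0r oppr_le0.
  have pi_gt0 : 0 < p i by rewrite lt_neqAle eq_sym pin0 p0.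
  have qi_gt0 : 0 < q i.
    rewrite lt_neqAle q0 andbT eq_sym; apply/eqP => /qp0 /eqP.
    by rewrite (negbTE pin0).
  rewrite /xlnx -mulrBr -lerN2 opprB -mulrN opprB.
  have -> : q i - p i = p i * ((q i - p i) / p i) by field; rewrite gt_eqF.
  by rewrite ler_wpM2l// ln_sub_le.
by apply: le_trans; rewrite sumrB subr_ge0.
Qed.

End XlnX.

(** * Entropy of finite-valued random variables *)

Section FiniteValued.
Context d {X : measurableType d} {R : realType} (P : probability X R).
Implicit Types (I J T U : finType).

Lemma sum_pair T U (F : T * U -> R) : \sum_p F p = \sum_t \sum_u F (t, u).
Proof. by rewrite pair_bigA; apply: eq_bigr => -[]. Qed.

Definition finite_rv T (Z : X -> T) := forall t, measurable (Z @^-1` [set t]).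

Definition law T (Z : X -> T) (t : T) : R := fine (P (Z @^-1` [set t])).

Definition entropy T (Z : X -> T) : R := - \sum_t xlnx (law Z t).

Lemma fin_num_prob (A : set X) : measurable A -> P A \is a fin_num.
Proof. by move=> mA; apply: fin_num_measure. Qed.

Lemma finite_rv_preimage T (Z : X -> T) (A : set T) :
  finite_rv Z -> measurable (Z @^-1` A).
Proof.
move=> mZ; have -> : Z @^-1` A = \bigcup_(t in A) Z @^-1` [set t].
  by apply/seteqP; split=> [x Ax|x [t At /= ->]//]; exists (Z x).
by apply: fin_bigcup_measurable => //; exact: finite_finset.
Qed.

Lemma finite_rv_comp T U (f : T -> U) (Z : X -> T) :
  finite_rv Z -> finite_rv (f \o Z).
Proof. by move=> mZ u; exact: (finite_rv_preimage (f @^-1` [set u])). Qed.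

Lemma finite_rv_pair T U (Z : X -> T) (W : X -> U) :
  finite_rv Z -> finite_rv W -> finite_rv (fun x => (Z x, W x)).
Proof.
move=> mZ mW [t u].
have -> : (fun x => (Z x, W x)) @^-1` [set (t, u)] =
    Z @^-1` [set t] `&` W @^-1` [set u].
  by apply/seteqP; split=> x /= [Zx Wx]; [split|rewrite Zx Wx].
exact: measurableI.
Qed.

Lemma finite_rv_finfun I T (Z : I -> X -> T) :
  (forall i, finite_rv (Z i)) -> finite_rv (fun x => [ffun i => Z i x]).
Proof.
move=> mZ f.
have -> : (fun x => [ffun i => Z i x]) @^-1` [set f] =
    \bigcap_(i in [set: I]) Z i @^-1` [set f i].
  apply/seteqP; split=> [x /= <- i _|x fx]; first by rewrite /= ffunE.
  by apply/ffunP => i; rewrite ffunE (fx i Logic.I).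
by apply: fin_bigcap_measurable => // i _; exact: mZ.
Qed.

Lemma law_ge0 T (Z : X -> T) t : 0 <= law Z t.
Proof. exact: fine_ge0. Qed.

Lemma prob_split T (Z : X -> T) (A : set X) : finite_rv Z -> measurable A ->
  fine (P A) = \sum_t fine (P (A `&` Z @^-1` [set t])).
Proof.
move=> mZ mA.
have mAZ t : measurable (A `&` Z @^-1` [set t]) by exact: measurableI.
apply: EFin_inj; rewrite fineK ?fin_num_prob// -sumEFin.
under eq_bigr do rewrite fineK ?fin_num_prob//.
rewrite (bigfs _ (index_enum_uniq T))//; last by move=> i _; rewrite mem_index_enum.
rewrite -measure_fin_bigcup//=; last first.
  by move=> t u _ _ [x [[_ <-] [_ <-]]].
congr (P _); apply/seteqP; split=> [x Ax|x [t _ []]//].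
by exists (Z x).
Qed.

Lemma law_sum T (Z : X -> T) (p : pred T) : finite_rv Z ->
  fine (P [set x | p (Z x)]) = \sum_(t | p t) law Z t.
Proof.
move=> mZ; rewrite (prob_split mZ); last exact: (finite_rv_preimage [set t | p t]).
rewrite [RHS]big_mkcond; apply: eq_bigr => t _; case: ifPn => pt.
  rewrite /law; congr (fine (P _)).
    by apply/seteqP; split=> [x []//|x /= Zt]; split=> //=; rewrite Zt.
rewrite (_ : _ `&` _ = set0) ?measure0//; apply/seteqP; split=> // x /= [pZ Zt].
by move: pt; rewrite -Zt pZ.
Qed.

Lemma law_comp T U (f : T -> U) (Z : X -> T) u : finite_rv Z ->
  law (f \o Z) u = \sum_(t | f t == u) law Z t.
Proof.
move=> mZ; rewrite -law_sum// /law; congr (fine (P _)).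
by apply/seteqP; split=> x /= /eqP.
Qed.

Lemma sum_law T (Z : X -> T) : finite_rv Z -> \sum_t law Z t = 1.
Proof.
move=> mZ; rewrite -(law_sum xpredT)// (_ : [set x | _] = setT) ?probability_setT//.
by apply/seteqP; split.
Qed.

Lemma law_expect T U (f : T -> U) (G : U -> R) (Z : X -> T) : finite_rv Z ->
  \sum_t law Z t * G (f t) = \sum_u law (f \o Z) u * G u.
Proof.
move=> mZ; rewrite (partition_big f xpredT)//=; apply: eq_bigr => u _.
by rewrite law_comp// mulr_suml; apply: eq_bigr => t /eqP ->.
Qed.

Lemma law_le_comp T U (f : T -> U) (Z : X -> T) t : finite_rv Z ->
  law Z t <= law (f \o Z) (f t).
Proof.
move=> mZ; rewrite law_comp// (bigD1 t)//= lerDl sumr_ge0// => *.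
exact: law_ge0.
Qed.

Lemma law_le1 T (Z : X -> T) t : finite_rv Z -> law Z t <= 1.
Proof.
move=> mZ; rewrite -(sum_law mZ) (bigD1 t)//= lerDl sumr_ge0// => *.
exact: law_ge0.
Qed.

(** Each atom of Z lies in one of f o Z, so it has a smaller probability and
    contributes a larger - ln. *)
Lemma entropy_comp_le T U (f : T -> U) (Z : X -> T) : finite_rv Z ->
  entropy (f \o Z) <= entropy Z.
Proof.
move=> mZ; rewrite /entropy lerN2 /xlnx -(law_expect f (fun u => ln (law (f \o Z) u)))//.
apply: ler_sum => t _; have [->|tn0] := eqVneq (law Z t) 0; first by rewrite !mul0r.
have t0 : 0 < law Z t by rewrite lt_neqAle eq_sym tn0 law_ge0.
have tf := law_le_comp f t mZ.
by rewrite ler_wpM2l// ?law_ge0// ler_ln// posrE (lt_le_trans t0).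
Qed.

Lemma entropy_comp_can T U (f : T -> U) (g : U -> T) (Z : X -> T) :
  finite_rv Z -> cancel f g -> entropy (f \o Z) = entropy Z.
Proof.
move=> mZ fK; apply/eqP; rewrite eq_le entropy_comp_le//=.
have {1}-> : Z = g \o (f \o Z) by apply/funext => x /=; rewrite fK.
by apply: entropy_comp_le; exact: finite_rv_comp.
Qed.

Lemma entropy_ge0 T (Z : X -> T) : finite_rv Z -> 0 <= entropy Z.
Proof.
move=> mZ; rewrite /entropy -sumrN sumr_ge0// => t _.
by rewrite oppr_ge0 xlnx_le0// law_ge0 law_le1.
Qed.

(** When b = j has probability 0 this is 0, not a probability vector in i;
    hence the inequality in sum_cond_law_le1. *)
Definition cond_law I J (c : X -> I) (b : X -> J) (i : I) (j : J) : R :=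
  law (fun x => (c x, b x)) (i, j) / law b j.

Definition cond_entropy I J (c : X -> I) (b : X -> J) : R :=
  - \sum_ij law (fun x => (c x, b x)) ij * ln (cond_law c b ij.1 ij.2).

Lemma cond_law_ge0 I J (c : X -> I) (b : X -> J) i j : 0 <= cond_law c b i j.
Proof. by rewrite divr_ge0// law_ge0. Qed.

Lemma sum_joint_law I J (c : X -> I) (b : X -> J) j :
  finite_rv c -> finite_rv b ->
  \sum_i law (fun x => (c x, b x)) (i, j) = law b j.
Proof.
move=> mc mb; have mcb := finite_rv_pair mc mb.
rewrite -[RHS]/(law (snd \o (fun x => (c x, b x))) j) law_comp//.
rewrite (reindex_onto (fun i => (i, j)) fst) => [|[i j'] /= /eqP -> //].
by apply: eq_bigl => i; rewrite /= !eqxx.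
Qed.

Lemma joint_law_le I J (c : X -> I) (b : X -> J) i j :
  finite_rv c -> finite_rv b -> law (fun x => (c x, b x)) (i, j) <= law b j.
Proof.
by move=> mc mb; apply: (law_le_comp snd (i, j)); exact: finite_rv_pair.
Qed.

Lemma sum_cond_law_le1 I J (c : X -> I) (b : X -> J) j :
  finite_rv c -> finite_rv b -> \sum_i cond_law c b i j <= 1.
Proof.
move=> mc mb; rewrite /cond_law -mulr_suml sum_joint_law//.
by have [->|?] := eqVneq (law b j) 0; rewrite ?mul0r// divff.
Qed.

Lemma cond_law_le1 I J (c : X -> I) (b : X -> J) i j :
  finite_rv c -> finite_rv b -> cond_law c b i j <= 1.
Proof.
move=> mc mb; apply: le_trans (sum_cond_law_le1 j mc mb).
by rewrite (bigD1 i)//= lerDl sumr_ge0// => *; exact: cond_law_ge0.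
Qed.

Lemma ln_prod I (F : I -> R) : (forall i, 0 < F i) ->
  ln (\prod_i F i) = \sum_i ln (F i).
Proof.
move=> F0; suff [] : 0 < \prod_i F i /\ ln (\prod_i F i) = \sum_i ln (F i) by [].
apply: (big_rec2 (fun x y => 0 < x /\ ln x = y)); first by rewrite ln1.
by move=> i x y _ [x0 <-]; rewrite mulr_gt0// lnM ?posrE.
Qed.

(** Subadditivity of entropy in one step: apply the Gibbs inequality to the
    reference law under which W keeps its law and the c j are, given W,
    independent and distributed according to their conditional laws given beta
    j o W. *)
Lemma joint_entropy_le n I J T (c : 'I_n -> X -> I) (W : X -> T)
    (beta : 'I_n -> T -> J) : (forall j, finite_rv (c j)) -> finite_rv W ->
  entropy (fun x => ([ffun j => c j x], W x)) <=
    entropy W + \sum_j cond_entropy (c j) (beta j \o W).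
Proof.
move=> mc mW; set Z := fun x => _.
have mZ : finite_rv Z by apply: finite_rv_pair => //; exact: finite_rv_finfun.
have mb j : finite_rv (beta j \o W) by exact: finite_rv_comp.
pose r j (aw : {ffun 'I_n -> I} * T) :=
  cond_law (c j) (beta j \o W) (aw.1 j) (beta j aw.2).
pose q aw := law W aw.2 * \prod_j r j aw.
have ZW aw : law Z aw <= law W aw.2 by exact: (law_le_comp snd).
have Zc j aw : law Z aw <=
    law (fun x => (c j x, (beta j \o W) x)) (aw.1 j, beta j aw.2).
  have -> : (fun x => (c j x, (beta j \o W) x)) =
    (fun aw : {ffun 'I_n -> I} * T => (aw.1 j, beta j aw.2)) \o Z.
    by apply/funext => x; rewrite /= ffunE.
  exact: (law_le_comp (fun aw : {ffun 'I_n -> I} * T => (aw.1 j, beta j aw.2))).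
have r0 j aw : r j aw = 0 -> law Z aw = 0.
  move/eqP; rewrite mulf_eq0 invr_eq0 => /orP[] /eqP h; apply: le_anti;
    rewrite law_ge0 andbT.
    by rewrite -h; exact: Zc.
  by rewrite -h; apply: le_trans (Zc j aw) _; exact: joint_law_le.
have q0 aw : q aw = 0 -> law Z aw = 0.
  move/eqP; rewrite mulf_eq0 => /orP[/eqP h|/prodf_eq0[j _ /eqP]]; last exact: r0.
  by apply: le_anti; rewrite law_ge0 andbT -h ZW.
have sumq : \sum_aw q aw <= \sum_aw law Z aw.
  rewrite (sum_law mZ) -(sum_law mW).
  rewrite sum_pair exchange_big/=.
  apply: ler_sum => w _; rewrite /q/= -mulr_sumr -[leRHS]mulr1.
  rewrite ler_wpM2l ?law_ge0//.
  rewrite -(bigA_distr_bigA (fun j i => cond_law (c j) (beta j \o W) i (beta j w))).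
  apply: Num.Theory.prodr_ile1 => j _; rewrite sum_cond_law_le1// andbT.
  by apply: sumr_ge0 => i _; exact: cond_law_ge0.
apply: le_trans (gibbs (fun=> law_ge0 _ _) _ q0 sumq) _.
  by move=> aw; rewrite mulr_ge0 ?law_ge0// prodr_ge0// => j _; exact: cond_law_ge0.
have -> : \sum_aw law Z aw * ln (q aw) =
    \sum_aw law Z aw * ln (law W aw.2) +
    \sum_j \sum_aw law Z aw * ln (r j aw).
  rewrite exchange_big -big_split; apply: eq_bigr => aw _ /=.
  rewrite -mulr_sumr -mulrDr.
  have [->|Zn0] := eqVneq (law Z aw) 0; first by rewrite !mul0r.
  have rp j : 0 < r j aw.
    rewrite lt_neqAle cond_law_ge0 andbT eq_sym.
    by apply: contra_neq Zn0; exact: r0.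
  congr (_ * _); rewrite /q lnM ?ln_prod// posrE ?prodr_gt0//.
  by apply: lt_le_trans (ZW aw); rewrite lt_neqAle eq_sym Zn0 law_ge0.
rewrite (law_expect snd (fun w => ln (law W w)))//= opprD lerD//.
rewrite -sumrN ler_sum// => j _; rewrite /cond_entropy lerN2.
rewrite le_eqVlt; apply/orP; left; apply/eqP.
rewrite (law_expect (fun aw : {ffun 'I_n -> I} * T => (aw.1 j, beta j aw.2))
  (fun ij => ln (cond_law (c j) (beta j \o W) ij.1 ij.2)))//.
apply: eq_bigr => ij _; congr (law _ _ * _).
by apply/funext => x; rewrite /= ffunE.
Qed.

(** If each event c = i is close to an event in terms of b only, then c is
    almost determined by b. On the atom b = j the conditional probability t of
    c = i should be close to 1 or to 0 according to D i j; the distance of t to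
    that value bounds - t ln t through the hypothesis on xlnx, and summing
    these distances over j gives the measure of the set where the two events
    differ. *)
Lemma cond_entropy_le I J (c : X -> I) (b : X -> J) (D : I -> pred J)
    (eps C : R) : finite_rv c -> finite_rv b -> 0 <= C ->
  (forall s t : R, 0 <= s <= 1 -> 0 <= t <= 1 ->
    `|xlnx s - xlnx t| <= eps + C * `|s - t|) ->
  cond_entropy c b <=
    #|I|%:R * eps + C * \sum_i fine (P [set x | (c x == i) != D i (b x)]).
Proof.
move=> mc mb C0 xC; have mcb := finite_rv_pair mc mb.
rewrite /cond_entropy sum_pair/=.
rewrite -sumrN.
have -> : #|I|%:R * eps + C * \sum_i fine (P [set x | (c x == i) != D i (b x)]) =
   \sum_i (eps + C * fine (P [set x | (c x == i) != D i (b x)])).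
  by rewrite big_split/= sumr_const mulr_sumr mulr_natl.
apply: ler_sum => i _.
rewrite (law_sum (Z := fun x => (c x, b x)) (fun ij => (ij.1 == i) != D i ij.2))//.
have -> : \sum_(ij | (ij.1 == i) != D i ij.2) law (fun x => (c x, b x)) ij =
    \sum_j (if D i j then law b j - law (fun x => (c x, b x)) (i, j)
            else law (fun x => (c x, b x)) (i, j)).
  rewrite big_mkcond sum_pair exchange_big/=.
  apply: eq_bigr => j _; case: ifP => Dij.
    rewrite -(sum_joint_law j mc mb) (bigD1 i)//= eqxx add0r.
    rewrite [in RHS](bigD1 i)//= addrAC subrr add0r; apply: eq_bigr => i' /negbTE ->.
    by [].
  rewrite (bigD1 i)//= eqxx big1 ?addr0// => i' /negbTE ->.
  by [].
rewrite -sumrN mulr_sumr -[eps]mul1r -(sum_law mb) mulr_suml -big_split/=.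
apply: ler_sum => j _.
have [b0|bn0] := eqVneq (law b j) 0.
  have -> : law (fun x => (c x, b x)) (i, j) = 0.
    by apply: le_anti; rewrite law_ge0 andbT -b0; exact: joint_law_le.
  by rewrite b0 subr0 !mul0r if_same mulr0 addr0 oppr0.
have b0 : 0 < law b j by rewrite lt_neqAle eq_sym bn0 law_ge0.
have -> : law (fun x => (c x, b x)) (i, j) = law b j * cond_law c b i j.
  by rewrite /cond_law mulrC divfK.
have r01 : 0 <= cond_law c b i j <= 1 by rewrite cond_law_ge0 cond_law_le1.
rewrite -mulrA -mulrN (_ : _ + C * _ = law b j *
  (eps + C * (if D i j then 1 - cond_law c b i j else cond_law c b i j))); last first.
  by case: ifP => _; ring.
rewrite ler_wpM2l ?law_ge0// -/(xlnx _).
set r := cond_law c b i j in r01 *; case/andP: (r01) => r0 r1.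
case: ifP => _.
  have := xC 1 r; rewrite !lexx ler01 xlnx1 sub0r => /(_ isT r01).
  by rewrite (ger0_norm (_ : 0 <= 1 - r)) ?subr_ge0//; apply: le_trans; rewrite ler_norm.
have := xC 0 r; rewrite !lexx ler01 xlnx0 !sub0r => /(_ isT r01).
by rewrite [`|- r|]normrN (ger0_norm r0); apply: le_trans; rewrite ler_norm.
Qed.

End FiniteValued.

(** * Stationary measures on two-sided sequences *)

Section ShiftSpace.
Context {R : realType} {E : pfinType}.
Local Notation Om := (shift_space E).
Implicit Types (s t : Om) (A B : set Om).

Definition word_at (m : int) (L : nat) (s : Om) : L.-tuple E :=
  [tuple s (m + j%:Z) | j < L].

Lemma cylinderE m L (w : L.-tuple E) : cylinder m w = word_at m L @^-1` [set w].
Proof.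
apply/seteqP; split=> s /=.
  by move=> sw; apply: eq_from_tnth => j; rewrite tnth_mktuple sw.
by move=> <- j; rewrite tnth_mktuple.
Qed.

Lemma open_coord (j : int) (e : E) :
  open ([set s | s j = e] : set (prod_topology (fun _ : int => discrete_topology E))).
Proof.
have oe : open ([set e] : set (discrete_topology E)) by exact: discrete_open.
have pc : continuous (fun s : prod_topology (fun _ : int => discrete_topology E) =>
    s j : discrete_topology E) by exact: (@proj_continuous int).
by have /continuousP/(_ _ oe) := pc.
Qed.

Lemma measurable_coord (j : int) (e : E) : measurable ([set s | s j = e] : set Om).
Proof. by apply: sub_sigma_algebra; exact: open_coord. Qed.

Lemma word_at_finite_rv m L : finite_rv (word_at m L).
Proof.
move=> w; rewrite -cylinderE.
have -> : cylinder m w = \bigcap_(j in [set: 'I_L]) [set s | s (m + j%:Z) = tnth w j].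
  by apply/seteqP; split=> [s sw j _|s sw j]; [exact: sw|exact: (sw j Logic.I)].
by apply: fin_bigcap_measurable => // j _; exact: measurable_coord.
Qed.

Definition agree (n : nat) s t := forall j : int, (`|j| <= n)%N -> s j = t j.

Definition local_set n A := forall s t, agree n s t -> A s -> A t.

Lemma agree_sym n s t : agree n s t -> agree n t s.
Proof. by move=> st j jn; rewrite st. Qed.

Lemma agree_trans n s t u : agree n s t -> agree n t u -> agree n s u.
Proof. by move=> st tu j jn; rewrite st// tu. Qed.

Lemma local_setS m n A : (m <= n)%N -> local_set m A -> local_set n A.
Proof. by move=> mn lA s t st; apply: lA => j jm; exact/st/(leq_trans jm). Qed.

Lemma local_setC n A : local_set n A -> local_set n (~` A).
Proof. by move=> lA s t st As At; apply: As; exact: lA (agree_sym st) At. Qed.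

Lemma local_setI n A B : local_set n A -> local_set n B -> local_set n (A `&` B).
Proof. by move=> lA lB s t st [As Bs]; split; [exact: lA st As|exact: lB st Bs]. Qed.

Lemma local_setU n A B : local_set n A -> local_set n B -> local_set n (A `|` B).
Proof.
by move=> lA lB s t st [As|Bs]; [left; exact: lA st As|right; exact: lB st Bs].
Qed.

Definition window n := word_at (- n%:Z) (n + n).+1.

Lemma agree_window n s t : window n s = window n t -> agree n s t.
Proof.
move=> st j jn; have jn' : (`|(j + n%:Z)%R| < (n + n).+1)%N by lia.
have := congr1 (fun w => tnth w (Ordinal jn')) st; rewrite !tnth_mktuple /=.
by have -> : - n%:Z + (`|(j + n%:Z)%R|)%N%:Z = j by lia.
Qed.

Lemma local_set_window n A : local_set n A -> A = window n @^-1` (window n @` A).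
Proof.
move=> lA; apply/seteqP; split=> [s As|s /= [t At ts]]; first by exists s.
by apply: lA At; exact: agree_window.
Qed.

Lemma local_set_measurable n A : local_set n A -> measurable A.
Proof.
move=> /local_set_window ->; apply: finite_rv_preimage; exact: word_at_finite_rv.
Qed.

(** Otherwise there are t n outside U that agree with s on [-n, n]; they
    converge to s coordinatewise, hence in the product topology. *)
Lemma open_agree (U : set (prod_topology (fun _ : int => discrete_topology E))) s :
  open U -> U s -> exists n, forall t, agree n s t -> U t.
Proof.
move=> oU Us; apply: contrapT => /forallNP noU.
have /choice[t tP] n : exists t, agree n s t /\ ~ U t.
  by have /existsNP[t /not_implyP] := noU n; exists t.
have ts : (t : nat -> prod_topology (fun _ : int => discrete_topology E)) @ \oo --> s.
  apply/cvg_sup => j A.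
  rewrite /= (@nbhsE (initial_topology (fun f : int -> discrete_topology E => f j))).
  move=> [_ [[C _ <-] Cs] CA]; exists `|j|%N => // n jn; apply: CA.
  by rewrite /= -((tP n).1 j jn).
have := ts U (open_nbhs_nbhs (conj oU Us)).
move=> [n _ /(_ n (leqnn n))]; exact: (tP n).2.
Qed.

Definition local_sets : set (set Om) := [set A | exists n, local_set n A].

(** An open set is the union over n of the sets of points all of whose
    companions on [-n, n] belong to it, and these are local. *)
Lemma shift_space_measurableE : @measurable _ Om = <<s local_sets >>.
Proof.
apply/seteqP; split; apply: smallest_sub.
- exact: smallest_sigma_algebra.
- move=> U oU; pose V n := [set s : Om | forall t, agree n s t -> U t].
  have -> : U = \bigcup_n V n.
    apply/seteqP; split=> [s Us|s [n _]]; last exact.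
    by have [n nP] := open_agree oU Us; exists n.
  apply: sigma_algebra_bigcup => n; apply: sub_sigma_algebra; exists n.
  by move=> s t st Vs u tu; apply: Vs; exact: agree_trans tu.
- exact: sigma_algebra_measurable.
- by move=> A [n]; exact: local_set_measurable.
Qed.

Lemma iter_left_shift n s (i : int) : iter n left_shift s i = s (i + n%:Z).
Proof.
elim: n i => [|n ih] i; first by rewrite addr0.
by rewrite /= /left_shift ih; congr (s _); lia.
Qed.

Lemma word_at_shift m L n s :
  word_at m L (iter n left_shift s) = word_at (m + n%:Z) L s.
Proof.
by apply: eq_from_tnth => j; rewrite !tnth_mktuple iter_left_shift addrAC.
Qed.

Lemma measurable_left_shift A : measurable A -> measurable (left_shift @^-1` A).
Proof.
rewrite {1}shift_space_measurableE => mA.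
have := @measurability _ _ _ _ setT (@left_shift E) local_sets shift_space_measurableE.
move=> h; rewrite -[X in measurable X]setTI; apply: h => //; last first.
  by rewrite shift_space_measurableE.
move=> _ [B [n lB] <-]; rewrite setTI; apply: (@local_set_measurable n.+1).
by move=> s t st; apply: lB => j jn; apply: st; lia.
Qed.

Section Measure.
Variable M : probability Om R.

(** The sets that can be approximated form a sigma-algebra which contains the
    local sets; a countable union is first replaced by a finite one. *)
Lemma local_set_approximation A (eps : R) : measurable A -> 0 < eps ->
  exists n B, local_set n B /\
    (M ((A `\` B) `|` (B `\` A)) <= eps%:E)%E.
Proof.
pose approximable A := measurable A /\ forall eps : R, 0 < eps ->
  exists n B, local_set n B /\ (M ((A `\` B) `|` (B `\` A)) <= eps%:E)%E.
have mD (B C : set Om) : measurable B -> measurable C ->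
    measurable ((B `\` C) `|` (C `\` B)).
  by move=> mB mC; apply: measurableU; exact: measurableD.
have approx_local n B : local_set n B -> approximable B.
  move=> lB; split; first exact: local_set_measurable lB.
  by move=> e e0; exists n, B; rewrite setDv setU0 measure0 lee_fin ltW.
have approxC B : approximable B -> approximable (~` B).
  move=> [mB aB]; split; first exact: measurableC.
  move=> e /aB[n [C [lC BC]]]; exists n, (~` C); split; first exact: local_setC.
  have mC := local_set_measurable lC.
  have m1 := mD _ _ (measurableC mB) (measurableC mC); have m2 := mD _ _ mB mC.
  apply: le_trans BC; apply: le_measure; rewrite ?inE//.
  by move=> s [[nB /contrapT Cs]|[nC /contrapT Bs]]; [right|left].
have approxU B C : approximable B -> approximable C -> approximable (B `|` C).
  move=> [mB aB] [mC aC]; split; first exact: measurableU.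
  move=> e e0; have e2 : 0 < e / 2 by rewrite divr_gt0.
  have [n [B' [lB BB']]] := aB _ e2; have [m [C' [lC CC']]] := aC _ e2.
  have mB' := local_set_measurable lB; have mC' := local_set_measurable lC.
  exists (maxn n m), (B' `|` C'); split.
    by apply: local_setU; [apply: local_setS lB; rewrite leq_maxl|
      apply: local_setS lC; rewrite leq_maxr].
  rewrite [e]splitr EFinD; apply: le_trans (leeD BB' CC').
  apply: le_trans (measureU2 _ _ _); [|exact: mD|exact: mD].
  have m1 := mD _ _ (measurableU _ _ mB mC) (measurableU _ _ mB' mC').
  have m2 := measurableU _ _ (mD _ _ mB mB') (mD _ _ mC mC').
  apply: le_measure; rewrite ?inE//.
  move=> s [[[Bs|Cs] /not_orP[nB nC]]|[[Bs|Cs] /not_orP[nB nC]]].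
  - by left; left.
  - by right; left.
  - by left; right.
  - by right; right.
have approx_bigcup (F : (set Om)^nat) : (forall n, approximable (F n)) ->
    approximable (\bigcup_n F n).
  move=> aF; have mF n : measurable (F n) by have [] := aF n.
  have mUF : measurable (\bigcup_n F n) by exact: bigcupT_measurable.
  split=> // e e0; have e2 : 0 < e / 2 by rewrite divr_gt0.
  (* G n decreases to the empty set: a finite union has nearly full measure. *)
  pose G n := \bigcup_n F n `\` \big[setU/set0]_(k < n) F k.
  have mG n : measurable (G n) by apply: measurableD => //; exact: bigsetU_measurable.
  have : (M \o G) n @[n --> \oo] --> M (\bigcap_n G n).
    apply: nonincreasing_cvg_mu => //.
    - by rewrite ltey_eq fin_num_prob.
    - exact: bigcapT_measurable.
    - move=> m n mn; apply/subsetPset; apply: setDS; apply: subset_bigsetU => //.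
  have -> : \bigcap_n G n = set0.
    apply/seteqP; split=> // s Gs; have [[n _ Fs] _] := Gs 0%N Logic.I.
    have [_] := Gs n.+1 Logic.I; apply.
    by rewrite big_ord_recr/=; right.
  rewrite measure0 => /fine_cvgP[_ /cvgr_lt/(_ _ e2)[n _ /(_ n (leqnn n)) /= Gn]].
  have [_ /(_ _ e2)[m [B [lB BF]]]] : approximable (\big[setU/set0]_(k < n) F k).
    by apply: (big_ind approximable) => //; exact: (approx_local 0%N).
  have mB := local_set_measurable lB.
  exists m, B; split=> //; rewrite [e]splitr EFinD.
  have {}Gn : (M (G n) <= (e / 2)%:E)%E.
    by rewrite -(@fineK _ (M (G n))) ?fin_num_prob// lee_fin ltW.
  have mUn : measurable (\big[setU/set0]_(k < n) F k) by exact: bigsetU_measurable.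
  apply: le_trans (leeD Gn BF).
  apply: le_trans (measureU2 _ _ _); [|exact: mG|exact: mD].
  have m1 := mD _ _ mUF mB; have m2 := measurableU _ _ (mG n) (mD _ _ mUn mB).
  apply: le_measure; rewrite ?inE//.
  move=> s [[UFs nB]|[Bs nUF]].
    have [Us|nUs] := pselect ((\big[setU/set0]_(k < n) F k) s).
      by right; left.
    by left; split.
  right; right; split=> // Us; apply: nUF.
  by apply: bigsetU_bigcup Us.
have sub : @measurable _ Om `<=` approximable.
  rewrite shift_space_measurableE; apply: smallest_sub; last first.
    by move=> B [n]; exact: approx_local.
  split=> //; first exact: (approx_local 0%N).
  by move=> B /approxC; rewrite setTD.
by move=> mA; have [_ ] := sub _ mA; apply.
Qed.

Definition stationary := forall m m' L (w : L.-tuple E),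
  M (cylinder m w) = M (cylinder m' w).

Hypothesis M_stationary : stationary.

Lemma law_word_at m m' L : law M (word_at m L) =1 law M (word_at m' L).
Proof. by move=> w; rewrite /law -!cylinderE (M_stationary m m'). Qed.

(** Two measures that agree on the local sets, which are stable under
    intersection, are equal. *)
Lemma left_shift_preserves A : measurable A -> M (left_shift @^-1` A) = M A.
Proof.
have mS : measurable_fun setT (@left_shift E).
  by move=> _ B mB; rewrite setTI; exact: measurable_left_shift.
move=> mA; apply: (@measure_unique _ _ _ local_sets (fun=> setT) _ _ _ _
  (pushforward M (@left_shift E)) M _ _ A mA).
- exact: shift_space_measurableE.
- move=> B C [m lB] [n lC]; exists (maxn m n).
  by apply: local_setI; [apply: local_setS lB; rewrite leq_maxl|
      apply: local_setS lC; rewrite leq_maxr].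
- by exists 0%N.
- by apply/seteqP; split=> // s _; exists 0%N.
- move=> B [n lB]; pose p w := `[< (window n @` B) w >].
  have mB := local_set_measurable lB; have mSB := measurable_left_shift mB.
  have BE : B = [set s | p (window n s)].
    rewrite {1}(local_set_window lB).
    by apply/seteqP; split=> s /= ws; apply/asboolP.
  rewrite /pushforward -[LHS]fineK ?fin_num_prob// -[RHS]fineK ?fin_num_prob//.
  congr EFin.
  transitivity (fine (M [set s | p (word_at (- n%:Z + 1) (n + n).+1 s)])).
    congr (fine (M _)); rewrite BE; apply/seteqP.
    by split=> s /=; rewrite /window -(word_at_shift _ _ 1).
  rewrite BE !law_sum; try exact: word_at_finite_rv.
  by apply: eq_bigr => w _; exact: law_word_at.
- move=> _; apply: (@le_lt_trans _ _ 1%E); last exact: ltry.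
  exact: (probability_le1 M measurableT).
Qed.

Lemma measurable_iter_left_shift n A :
  measurable A -> measurable (iter n left_shift @^-1` A).
Proof.
elim: n A => //= n ih A mA.
exact: (ih (left_shift @^-1` A) (measurable_left_shift mA)).
Qed.

Lemma iter_left_shift_preserves n A :
  measurable A -> M (iter n left_shift @^-1` A) = M A.
Proof.
elim: n A => //= n ih A mA; rewrite -[RHS]left_shift_preserves//.
exact: (ih (left_shift @^-1` A) (measurable_left_shift mA)).
Qed.

Lemma law_shift (T : finType) (Z : Om -> T) n z : finite_rv Z ->
  law M (Z \o iter n left_shift) z = law M Z z.
Proof.
by move=> mZ; rewrite /law comp_preimage iter_left_shift_preserves//; exact: mZ.
Qed.

Lemma finite_rv_shift (T : finType) (Z : Om -> T) n : finite_rv Z ->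
  finite_rv (Z \o iter n left_shift).
Proof.
by move=> mZ t; rewrite comp_preimage; exact: measurable_iter_left_shift.
Qed.

Lemma cond_entropy_shift (I J : finType) (c : Om -> I) (b : Om -> J) n :
  finite_rv c -> finite_rv b ->
  cond_entropy M (c \o iter n left_shift) (b \o iter n left_shift) =
  cond_entropy M c b.
Proof.
move=> mc mb; have mcb := finite_rv_pair mc mb.
congr (- _); apply: eq_bigr => -[i j] _ /=.
rewrite /cond_law (law_shift n j mb).
by rewrite -(law_shift n (i, j) mcb).
Qed.

Definition itinerary (I : finType) (c : Om -> I) n s : {ffun 'I_n -> I} :=
  [ffun j => c (iter (val j) left_shift s)].

Lemma itinerary_finite_rv (I : finType) (c : Om -> I) n :
  finite_rv c -> finite_rv (itinerary c n).
Proof.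
by move=> mc; apply: finite_rv_finfun => j; exact: (finite_rv_shift j mc).
Qed.

Definition block_entropy L := entropy M (word_at 0 L).

Lemma entropy_word_at m L : entropy M (word_at m L) = block_entropy L.
Proof.
by congr (- _); apply: eq_bigr => w _; rewrite (law_word_at m 0).
Qed.

(** The window around time j is a subword of the word at times - m to n + m,
    and the conditional entropies given these windows are all equal by
    stationarity. *)
Lemma entropy_itinerary_le (I : finType) (c : Om -> I) m n : finite_rv c ->
  entropy M (itinerary c n) <=
    block_entropy (n + (m + m).+1) + n%:R * cond_entropy M c (window m).
Proof.
move=> mc; pose W := word_at (- m%:Z) (n + (m + m).+1).
pose beta (j : 'I_n) (w : (n + (m + m).+1).-tuple E) : (m + m).+1.-tuple E :=
  [tuple nth point w (j + i) | i < (m + m).+1].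
(* j + i stays below the length of w, so the default value is never read. *)
have betaW j : beta j \o W = window m \o iter j left_shift.
  apply/funext => s; apply: eq_from_tnth => i; rewrite /= !tnth_mktuple.
  have ji : (j + i < n + (m + m).+1)%N by have := ltn_ord i; have := ltn_ord j; lia.
  rewrite -[X in nth _ _ X]/(nat_of_ord (Ordinal ji)) -tnth_nth tnth_mktuple.
  by rewrite iter_left_shift; congr (s _) => /=; lia.
have mW : finite_rv W by exact: word_at_finite_rv.
have mcj (j : 'I_n) : finite_rv (c \o iter j left_shift) by exact: finite_rv_shift.
have := joint_entropy_le M beta mcj mW.
rewrite entropy_word_at (eq_bigr (fun=> cond_entropy M c (window m))); last first.
  by move=> j _; rewrite betaW cond_entropy_shift//; exact: word_at_finite_rv.
rewrite sumr_const card_ord mulr_natl.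
apply: le_trans.
exact: (entropy_comp_le M fst (finite_rv_pair (itinerary_finite_rv (n := n) mc) mW)).
Qed.

End Measure.
End ShiftSpace.

(** * The Kolmogorov-Sinai entropy of the shift *)

Section KolmogorovSinai.
Context {R : realType} {E : pfinType}.
Local Notation Om := (shift_space E).
Variable M : probability Om R.

Lemma cond_entropy_window_small (I : finType) (c : Om -> I) (eps : R) :
  finite_rv c -> 0 < eps -> exists m, cond_entropy M c (window m) <= eps.
Proof.
move=> mc eps0; have k0 : 0 < #|I|%:R + 1 :> R by rewrite ltr_wpDl.
(* e1 is the additive error on each of the #|I| terms; the linear constant C it
   gives determines the precision e2 of the approximations. *)
pose e1 := eps / 2 / (#|I|%:R + 1); have e10 : 0 < e1 by rewrite !divr_gt0.
have [C C0 xC] := xlnx_almost_lipschitz e10.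
have C10 : 0 < C + 1 by rewrite ltr_wpDl.
pose e2 := e1 / (C + 1); have e20 : 0 < e2 by rewrite divr_gt0.
have /choice[nB nBP] (i : I) : exists nB : nat * set Om, local_set nB.1 nB.2 /\
   (M ((c @^-1` [set i] `\` nB.2) `|` (nB.2 `\` c @^-1` [set i])) <= e2%:E)%E.
  have [n [B]] := local_set_approximation M (mc i) e20.
  by exists (n, B).
pose m := (\max_i (nB i).1)%N; exists m.
have lB i : local_set m (nB i).2.
  by apply: local_setS (nBP i).1; exact: leq_bigmax.
pose D i w := `[< (window m @` (nB i).2) w >].
have mw : finite_rv (window m : Om -> _) by exact: word_at_finite_rv.
have := cond_entropy_le M D mc mw C0 xC.
move/le_trans; apply.
have De i : fine (M [set x | (c x == i) != D i (window m x)]) <= e2.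
  rewrite -lee_fin fineK; last first.
    apply: fin_num_prob.
    exact: (finite_rv_preimage [set p : I * _ | (p.1 == i) != D i p.2]
      (finite_rv_pair mc mw)).
  have mB := local_set_measurable (nBP i).1.
  apply: (le_trans _ (nBP i).2); apply: le_measure; rewrite ?inE.
  - exact: (finite_rv_preimage [set p : I * _ | (p.1 == i) != D i p.2]
      (finite_rv_pair mc mw)).
  - exact: measurableU (measurableD (mc i) mB) (measurableD mB (mc i)).
  move=> s /=; have DE : D i (window m s) <-> (nB i).2 s.
    rewrite [X in _ <-> X s](local_set_window (lB i)) /D /=.
    by split=> [/asboolP|h]; [|apply/asboolP].
  case: (c s =P i) => [cs|cs]; case Ds: (D i (window m s)) => //= _.
    by left; split=> // /DE; rewrite Ds.
  by right; split=> //; apply/DE.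
have : \sum_i fine (M [set x | (c x == i) != D i (window m x)]) <= #|I|%:R * e2.
  by rewrite mulr_natl -sumr_const; exact: ler_sum.
set S := \sum_i _ => Se.
have h1 : #|I|%:R * e1 <= eps / 2.
  rewrite /e1 mulrA ler_pdivrMr// mulrC.
  by rewrite ler_wpM2l ?lerDl ?divr_ge0 ?(ltW eps0).
have h2 : C * S <= eps / 2.
  apply: (@le_trans _ _ (C * (#|I|%:R * e2))); first by rewrite ler_wpM2l.
  apply: le_trans h1; rewrite mulrCA ler_wpM2l// /e2 mulrA ler_pdivrMr//.
  by rewrite mulrC ler_wpM2l ?lerDl ?(ltW e10).
by rewrite [leRHS]splitr lerD.
Qed.

Hypothesis M_stationary : stationary M.
Variable h : R.
Hypothesis block_entropy_rate : block_entropy M n.+1 / n.+1%:R @[n --> \oo] --> h.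

Lemma shifted_block_entropy_rate K :
  block_entropy M (n.+1 + K) / n.+1%:R @[n --> \oo] --> h.
Proof.
have -> : (fun n => block_entropy M (n.+1 + K) / n.+1%:R) =
  (fun n => block_entropy M (n + K).+1 / (n + K).+1%:R * (1 + K%:R * n.+1%:R^-1)).
  have split_ratio (x y z : R) : x != 0 -> x + y != 0 ->
    z / x = z / (x + y) * (1 + y / x) by move=> x0 xy0; field; rewrite ?x0 ?xy0.
  apply/funext => n; rewrite -addSn natrD; apply: split_ratio.
    by rewrite pnatr_eq0.
  by rewrite -natrD pnatr_eq0.
rewrite -[h]mulr1; apply: cvgM.
  by have := block_entropy_rate; rewrite -(cvg_shiftn K).
rewrite -[X in _ --> X]addr0; apply: cvgD; first exact: cvg_cst.
by rewrite -(mulr0 K%:R); apply: cvgMr; exact: cvg_harmonic.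
Qed.

(** Divide the bound of entropy_itinerary_le by n: the window has a fixed
    length, so its contribution to the block length disappears in the limit. *)
Lemma entropy_rate_itinerary (I : finType) (c : Om -> I) (l : R) : finite_rv c ->
  entropy M (itinerary c n.+1) / n.+1%:R @[n --> \oo] --> l -> l <= h.
Proof.
move=> mc ul; apply/ler_addgt0Pr => eps eps0.
have [m cm] := cond_entropy_window_small mc eps0.
have vh := shifted_block_entropy_rate (m + m).+1.
apply: ler_cvg_to ul (cvgD vh (cvg_cst eps)) _.
apply: nearW => n /=; rewrite ler_pdivrMr// mulrDl divfK ?pnatr_eq0//.
apply: le_trans (entropy_itinerary_le M_stationary m n.+1 mc) _.
by rewrite lerD2l mulrC ler_wpM2r.
Qed.

(** A partition is the same as the function that names the cell of a point; the
    cells of its joins are then the events of a given itinerary. *)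
Lemma partition_itinerary k (A : 'I_k -> set Om) :
  partition [set: 'I_k] A [set: Om] -> exists c : Om -> 'I_k,
    (forall i, A i = c @^-1` [set i]) /\
    forall n, set_entropy M (iter_join left_shift A (n := n)) =
      entropy M (itinerary c n).
Proof.
move=> [Acov Atriv _].
have /choice[c cA] (s : Om) : exists i, A i s.
  by have : [set: Om] s by []; rewrite -Acov => -[i _]; exists i.
have AE i : A i = c @^-1` [set i].
  apply/seteqP; split=> [s As|s /= <-]; last exact: cA.
  by apply: (Atriv (c s) i) => //; exists s.
exists c; split=> // n; congr (- _); apply: eq_bigr => f _.
have -> : iter_join left_shift A f = itinerary c n @^-1` [set f].
  apply/seteqP; split=> s /= => [fs|<- j]; last by rewrite AE /= ffunE.
  by apply/ffunP => j; rewrite ffunE; have := fs j; rewrite AE.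
by [].
Qed.

Lemma block_entropy_itinerary L :
  entropy M (itinerary (fun s : Om => enum_rank (s 0)) L) = block_entropy M L.
Proof.
pose f (w : L.-tuple E) : {ffun 'I_L -> 'I_#|E|} := [ffun j => enum_rank (tnth w j)].
pose g (u : {ffun 'I_L -> 'I_#|E|}) : L.-tuple E := [tuple enum_val (u j) | j < L].
have -> : itinerary (fun s : Om => enum_rank (s 0)) L = f \o word_at 0 L.
  apply/funext => s; apply/ffunP => j; rewrite !ffunE tnth_mktuple.
  by rewrite iter_left_shift.
apply: (@entropy_comp_can _ _ _ _ _ _ f g); first exact: word_at_finite_rv.
by move=> w; apply: eq_from_tnth => j; rewrite tnth_mktuple ffunE enum_rankK.
Qed.

Lemma block_entropy_ge0 L : 0 <= block_entropy M L.
Proof. by apply: entropy_ge0; exact: word_at_finite_rv. Qed.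

(** The one-letter partition reaches the value h, and entropy_rate_itinerary
    bounds all others by it. *)
Theorem shift_KS_entropy : KS_entropy M (@left_shift E) = h%:E.
Proof.
have limh : lim (block_entropy M n.+1 / n.+1%:R @[n --> \oo]) = h.
  exact: cvg_lim.
apply/eqP; rewrite eq_le; apply/andP; split.
  apply: ge_ereal_sup => _ [k [A [Apart mA ->]]]; rewrite lee_fin.
  have [c [Ac Ae]] := partition_itinerary Apart.
  have mc : finite_rv c by move=> i; rewrite -Ac.
  rewrite /partition_entropy; under eq_fun do rewrite Ae.
  have [cu|ncu] := pselect (cvgn (fun n => entropy M (itinerary c n.+1) / n.+1%:R)).
    exact: entropy_rate_itinerary mc cu.
  (* The limit operator sends a divergent sequence to 0, and 0 <= h. *)
  rewrite (dvgP ncu) -limh; apply: limr_ge; first by apply/cvg_ex; exists h.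
  by apply: nearW => n; rewrite divr_ge0// block_entropy_ge0.
pose A (i : 'I_#|E|) := [set s : Om | enum_rank (s 0) = i].
apply: ereal_sup_ubound; exists #|E|, A.
have Apart : partition [set: 'I_#|E|] A [set: Om].
  split.
  - by apply/seteqP; split=> // s _; exists (enum_rank (s 0)).
  - by move=> i j _ _ [s [<- <-]].
  - by move=> i _; exists (fun=> enum_val i); rewrite /A /= enum_valK.
split=> //.
  move=> i; have -> : A i = [set s | s 0 = enum_val i].
    by rewrite /A; apply/seteqP; split=> s /= => [<-|->]; rewrite ?enum_rankK ?enum_valK.
  exact: measurable_coord.
have [c [Ac Ae]] := partition_itinerary Apart.
rewrite -limh /partition_entropy; congr (limn _)%:E; apply/funext => n.
rewrite Ae -block_entropy_itinerary; congr (entropy M (itinerary _ _) / _).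
by apply/funext => s; have : A (c s) s by rewrite Ac.
Qed.

End KolmogorovSinai.

(** * Words of a Markov system *)

Section TupleSums.
Context {R : nmodType} {E : finType}.
Implicit Type G : seq E -> R.

Lemma sum_tuple0 G : \sum_(w : 0.-tuple E) G w = G [::].
Proof.
rewrite (bigD1 [tuple])//= big1 ?addr0// => w /eqP; case.
by apply/val_inj; rewrite /= (tuple0 w).
Qed.

Lemma sum_tuple_cons n G :
  \sum_(w : n.+1.-tuple E) G w = \sum_e \sum_(w : n.-tuple E) G (e :: w).
Proof.
rewrite pair_bigA (reindex (fun p : E * n.-tuple E => [tuple of p.1 :: p.2]))//=.
exists (fun w : n.+1.-tuple E => (thead w, [tuple of behead w])) => [[e w] _|w _].
  by congr pair; apply/val_inj.
by rewrite /= [RHS]tuple_eta.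
Qed.

Lemma sum_tuple_rcons n G :
  \sum_(w : n.+1.-tuple E) G w = \sum_(w : n.-tuple E) \sum_e G (rcons w e).
Proof.
elim: n G => [|n ih] G.
  rewrite sum_tuple_cons (sum_tuple0 (fun w => \sum_e G (rcons w e)))/=.
  by apply: eq_bigr => e _; rewrite (sum_tuple0 (fun w => G (e :: w))).
rewrite sum_tuple_cons (sum_tuple_cons _ (fun w => \sum_e G (rcons w e))).
by apply: eq_bigr => e _; rewrite (ih (fun w => G (e :: w))).
Qed.

End TupleSums.

Section Paths.
Context {R : realType} {K : pmetricType R} {N : nat} {E : finType}.
Variable Ms : markovSystem K N E.
Implicit Types (x y : K) (w : seq E) (f g : K -> R) (i j : 'I_N) (e : E).

Definition word_map w x := foldl (fun y e => edge_map Ms e y) x w.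

Lemma path_prob_rcons w e x :
  path_prob Ms (rcons w e) x = path_prob Ms w x * edge_prob Ms e (word_map w x).
Proof. by elim: w x => [|e' w ih] x /=; rewrite ?mulr1 ?mul1r// ih mulrA. Qed.

Lemma path_prob_ge0 w x : 0 <= path_prob Ms w x.
Proof. by elim: w x => //= e w ih x; rewrite mulr_ge0// edge_prob_ge0. Qed.

Lemma edge_prob_le1 e x : edge_prob Ms e x <= 1.
Proof.
rewrite -(edge_prob_sum1 Ms x) (bigD1 e)//= lerDl sumr_ge0// => *.
exact: edge_prob_ge0.
Qed.

Lemma path_prob_le1 w x : path_prob Ms w x <= 1.
Proof.
elim: w x => //= e w ih x.
by rewrite mulr_ile1// ?edge_prob_ge0 ?path_prob_ge0 ?edge_prob_le1.
Qed.

Lemma iter_markov_opE n f x : iter n (markov_op Ms) f x =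
  \sum_(w : n.-tuple E) path_prob Ms w x * f (word_map w x).
Proof.
elim: n x => [|n ih] x.
  by rewrite (sum_tuple0 (fun w => path_prob Ms w x * f (word_map w x)))/= mul1r.
rewrite (sum_tuple_cons _ (fun w => path_prob Ms w x * f (word_map w x)))/=.
apply: eq_bigr => e _; rewrite ih mulr_sumr.
by apply: eq_bigr => w _; rewrite mulrA.
Qed.

Lemma sum_path_prob n x : \sum_(w : n.-tuple E) path_prob Ms w x = 1.
Proof.
have : iter n (markov_op Ms) (fun=> 1) x = 1.
  elim: n x => //= n ih x; rewrite /markov_op.
  by under eq_bigr do rewrite ih mulr1; exact: edge_prob_sum1.
by rewrite iter_markov_opE; under eq_bigr do rewrite mulr1.
Qed.

Lemma cell_ini e x : edge_prob Ms e x != 0 -> cell Ms (ini Ms e) x.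
Proof. by move=> pe; apply: contrapT => /edge_prob_out/eqP; apply/negP. Qed.

Lemma cell_uniq i j x : cell Ms i x -> cell Ms j x -> i = j.
Proof.
have [_ triv _] := cell_partition Ms => ix jx.
by apply: triv => //; exists x.
Qed.

Lemma cell_exists x : exists i, cell Ms i x.
Proof.
have [cov _ _] := cell_partition Ms.
by have : [set: K] x by []; rewrite -cov => -[i _]; exists i.
Qed.

Lemma edge_map_ter e x :
  cell Ms (ini Ms e) x -> cell Ms (ter Ms e) (edge_map Ms e x).
Proof. by move=> ex; apply: edge_map_cell; exists x. Qed.

Lemma word_map_same_cell i w x y : cell Ms i x -> cell Ms i y ->
  path_prob Ms w x != 0 -> exists2 j, cell Ms j (word_map w x) &
                                     cell Ms j (word_map w y).
Proof.
elim: w i x y => [|e w ih] i x y /= ix iy; first by exists i.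
rewrite mulf_eq0 negb_or => /andP[/cell_ini ex wx].
have ie := cell_uniq ix ex; subst i.
exact: ih (edge_map_ter ix) (edge_map_ter iy) wx.
Qed.

Variable a : R.
Hypothesis Ms_contractive : contractive Ms a.
Hypothesis a_ge0 : 0 <= a.

(** Edges of positive probability keep points of a common cell in a common
    cell, so the contraction hypothesis can be iterated. *)
Lemma word_map_contraction n i x y : cell Ms i x -> cell Ms i y ->
  \sum_(w : n.-tuple E)
     path_prob Ms w x * mdist (word_map w x) (word_map w y) <= a ^+ n * mdist x y.
Proof.
elim: n i x y => [|n ih] i x y ix iy.
  rewrite (sum_tuple0 (fun w =>
    path_prob Ms w x * mdist (word_map w x) (word_map w y)))/=.
  by rewrite expr0.
rewrite (sum_tuple_cons _ (fun w =>
  path_prob Ms w x * mdist (word_map w x) (word_map w y)))/=.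
rewrite exprSr -mulrA.
apply: (@le_trans _ _ (a ^+ n * (\sum_e edge_prob Ms e x *
    mdist (edge_map Ms e x) (edge_map Ms e y)))); last first.
  by rewrite ler_wpM2l ?exprn_ge0//; exact: Ms_contractive ix iy.
rewrite mulr_sumr; apply: ler_sum => e _.
under eq_bigr do rewrite -mulrA.
rewrite -mulr_sumr [leRHS]mulrCA.
have [->|pe] := eqVneq (edge_prob Ms e x) 0; first by rewrite !mul0r.
have ex := cell_ini pe; have ie := cell_uniq ix ex; subst i.
rewrite ler_wpM2l ?edge_prob_ge0//.
exact: ih (edge_map_ter ix) (edge_map_ter iy).
Qed.

(** For a bounded function, equivalent to uniform continuity on each cell with
    a modulus common to all cells; in this form it is compatible with averaging
    over words. *)
Definition cellwise_uniform g := forall eps : R, 0 < eps -> exists2 C, 0 <= C &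
  forall i x y, cell Ms i x -> cell Ms i y -> `|g x - g y| <= eps + C * mdist x y.

Lemma cellwise_uniform_sum g : cellwise_uniform g -> forall eps : R, 0 < eps ->
  exists2 C, 0 <= C & forall n i x y, cell Ms i x -> cell Ms i y ->
    \sum_(w : n.-tuple E) path_prob Ms w x * `|g (word_map w x) - g (word_map w y)|
      <= eps + C * (a ^+ n * mdist x y).
Proof.
move=> ug eps eps0; have [C C0 gC] := ug _ eps0; exists C => // n i x y ix iy.
apply: (@le_trans _ _ (\sum_(w : n.-tuple E) (path_prob Ms w x * eps +
    C * (path_prob Ms w x * mdist (word_map w x) (word_map w y))))).
  apply: ler_sum => w _; have [->|pw] := eqVneq (path_prob Ms w x) 0.
    by rewrite !mul0r mulr0 addr0.
  have [j jx jy] := word_map_same_cell ix iy pw.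
  by rewrite mulrCA -mulrDr ler_wpM2l ?path_prob_ge0//; exact: gC jx jy.
rewrite big_split/= -mulr_suml sum_path_prob mul1r lerD2l -mulr_sumr.
by rewrite ler_wpM2l//; exact: word_map_contraction ix iy.
Qed.

End Paths.

(** * Integrals of bounded measurable functions *)

Section BoundedMeasurable.
Context d {T : measurableType d} {R : realType}.
Implicit Types (f g : T -> R).

Definition bounded_measurable f :=
  measurable_fun [set: T] f /\ exists B : R, forall x, `|f x| <= B.

Lemma bounded_measurable_cst (c : R) : bounded_measurable (fun=> c).
Proof. by split; [exact: measurable_cst|exists `|c|]. Qed.

Lemma bounded_measurableD f g : bounded_measurable f -> bounded_measurable g ->
  bounded_measurable (fun x => f x + g x).
Proof.
move=> [mf [B fB]] [mg [C gC]]; split; first exact: measurable_funD.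
by exists (B + C) => x; rewrite (le_trans (ler_normD _ _))// lerD.
Qed.

Lemma bounded_measurableM f g : bounded_measurable f -> bounded_measurable g ->
  bounded_measurable (fun x => f x * g x).
Proof.
move=> [mf [B fB]] [mg [C gC]]; split; first exact: measurable_funM.
by exists (B * C) => x; rewrite normrM ler_pM.
Qed.

Lemma bounded_measurable_norm f : bounded_measurable f ->
  bounded_measurable (fun x => `|f x|).
Proof.
move=> [mf [B fB]]; split; first exact: measurableT_comp.
by exists B => x; rewrite normr_id.
Qed.

Lemma bounded_measurable_sum (I : Type) (r : seq I) (f : I -> T -> R) :
  (forall i, bounded_measurable (f i)) ->
  bounded_measurable (fun x => \sum_(i <- r) f i x).
Proof.
move=> bf; elim: r => [|i r ih].
  by under eq_fun do rewrite big_nil; exact: bounded_measurable_cst.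
by under eq_fun do rewrite big_cons; exact: bounded_measurableD.
Qed.

Lemma bounded_measurableB f g : bounded_measurable f -> bounded_measurable g ->
  bounded_measurable (fun x => f x - g x).
Proof.
move=> bf bg; under eq_fun do rewrite -[X in _ - X]mul1r -mulNr.
by apply: bounded_measurableD bf (bounded_measurableM (bounded_measurable_cst _) bg).
Qed.

Variable P : probability T R.

Lemma bounded_measurable_integrable f :
  bounded_measurable f -> P.-integrable [set: T] (EFin \o f).
Proof.
move=> [mf [B fB]]; have PT : (P setT < +oo)%E by rewrite probability_setT ltry.
apply: measurable_bounded_integrable => //.
exists B; split; first exact: num_real.
by move=> M BM x _; exact: le_trans (fB x) (ltW BM).
Qed.

Lemma Rintegral_sum (I : Type) (r : seq I) (f : I -> T -> R) :
  (forall i, bounded_measurable (f i)) ->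
  \int[P]_x (\sum_(i <- r) f i x) = \sum_(i <- r) \int[P]_x f i x.
Proof.
move=> bf; elim: r => [|i r ih].
  by under eq_Rintegral do rewrite big_nil; rewrite Rintegral_cst// mul0r big_nil.
under eq_Rintegral do rewrite big_cons.
rewrite big_cons RintegralD// ?ih//; apply: bounded_measurable_integrable => //.
exact: bounded_measurable_sum.
Qed.

Lemma Rintegral_prob_cst (c : R) : \int[P]_(x in [set: T]) c = c.
Proof. by rewrite Rintegral_cst// (_ : fine (P setT) = 1) ?mulr1// probability_setT. Qed.

Lemma EFin_Rintegral f : bounded_measurable f ->
  (\int[P]_x f x)%:E = (\int[P]_x (f x)%:E)%E.
Proof.
move=> bf; rewrite fineK//.
exact: (integrable_fin_num measurableT (bounded_measurable_integrable bf)).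
Qed.

Lemma cvg_Rintegral (f_ : nat -> T -> R) f (B : R) :
  (forall n, measurable_fun [set: T] (f_ n)) -> measurable_fun [set: T] f ->
  (forall n x, `|f_ n x| <= B) ->
  {ae P, forall x, f_ n x @[n --> \oo] --> f x} ->
  \int[P]_x f_ n x @[n --> \oo] --> \int[P]_x f x.
Proof.
move=> mf_ mf fB f_f.
have mEf_ n : measurable_fun setT (EFin \o f_ n) by exact/measurable_EFinP.
have mEf : measurable_fun setT (EFin \o f) by exact/measurable_EFinP.
have Ef_f : {ae P, forall x, setT x -> (EFin \o f_ n) x @[n --> \oo] --> (EFin \o f) x}.
  by apply: filterS f_f => x fx _; apply: cvg_EFin fx; exact: nearW.
have intB : P.-integrable setT (EFin \o cst B) by exact: finite_measure_integrable_cst.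
have EfB : {ae P, forall x n, setT x -> (`|(EFin \o f_ n) x| <= (EFin \o cst B) x)%E}.
  by apply: aeW => x n _; rewrite /= lee_fin.
have [intf _ cvf] := dominated_convergence measurableT mEf_ mEf Ef_f intB EfB.
apply: fine_cvg.
by rewrite fineK//; exact: (integrable_fin_num measurableT).
Qed.

Lemma Rintegral_law (I : finType) (Z : T -> I) (phi : I -> R) : finite_rv Z ->
  \int[P]_x phi (Z x) = \sum_i law P Z i * phi i.
Proof.
move=> mZ; have bi i : bounded_measurable (fun x => phi i * \1_(Z @^-1` [set i]) x).
  apply: bounded_measurableM (bounded_measurable_cst _) _; split=> //.
  by exists 1 => x; rewrite indicE; case: (_ \in _); rewrite ?normr0 ?normr1.
transitivity (\int[P]_x \sum_i phi i * \1_(Z @^-1` [set i]) x).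
  apply: eq_Rintegral => x _; rewrite (bigD1 (Z x))//= big1 ?addr0.
    by rewrite indicE mem_set// mulr1.
  move=> i /eqP iZ; rewrite indicE memNset ?mulr0//=.
  by move=> Zi; apply: iZ.
rewrite Rintegral_sum//; apply: eq_bigr => i _.
rewrite RintegralZl//; last by apply: integrable_indic; exact: mZ.
by rewrite /Rintegral integral_indic ?setIT// mulrC.
Qed.

End BoundedMeasurable.

(** * Dini continuity implies uniform continuity *)

(** Directly from the definition of the integral as a supremum over simple
    functions; this form applies to the modulus of continuity, a supremum over
    pairs of points. *)
Lemma le_ge0_integral d (T : measurableType d) (R : realType)
    (mu : {measure set T -> \bar R}) (D : set T) (f g : T -> \bar R) :
  (forall x, D x -> 0 <= f x)%E -> (forall x, D x -> f x <= g x)%E ->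
  (\int[mu]_(x in D) f x <= \int[mu]_(x in D) g x)%E.
Proof.
move=> f0 fg; rewrite !ge0_integralE//; last first.
  by move=> x Dx; apply: le_trans (fg x Dx); exact: f0.
apply: ereal_sup_le => _ [h hf <-]; exists h => // x; apply: le_trans (hf x) _.
by rewrite !patchE; case: ifPn => // /set_mem; exact: fg.
Qed.

Section Dini.
Context {R : realType}.
Local Notation leb := (@lebesgue_measure R).

Let inv (t : R) : R := expR (- ln t).

Let invE (t : R) : 0 < t -> inv t = t^-1.
Proof. by move=> t0; rewrite /inv expRN lnK. Qed.

(** Each dyadic block from r / 2 to r contributes at least 1 / 2 to the
    integral of 1 / t. *)
Lemma integral_inv_unbounded n (r : R) : 0 < r ->
  ((n%:R / 2)%:E <= \int[leb]_(t in `]0%R, r[) (inv t)%:E)%E.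
Proof.
have inv_ge0 t : (0 <= (inv t)%:E)%E by rewrite lee_fin expR_ge0.
have minv (D : set R) : measurable_fun D (fun t => (inv t)%:E).
  apply/measurable_EFinP; apply: (@measurable_funS _ _ _ _ setT) => //.
  apply: measurableT_comp; first exact: measurable_expR.
  by apply: measurableT_comp => //; exact: measurable_ln.
elim: n r => [|n ih] r r0; first by rewrite mul0r integral_ge0.
have r2 : 0 < r / 2 by rewrite divr_gt0.
have rr : r / 2 < r by lra.
have -> : `]0%R, r[%classic = `]0%R, (r / 2)[%classic `|` `[(r / 2), r[%classic.
  by rewrite -itv_bndbnd_setU//= bnd_simp ltW.
rewrite ge0_integral_setU//; last first.
  rewrite disj_set2E; apply/eqP; apply/seteqP; split=> // t /=.
  by rewrite !in_itv/= => -[/andP[_ ?] /andP[? _]]; lra.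
  exact: minv.
(* The block [r / 2, r[ has length r / 2 and 1 / t >= 1 / r on it. *)
have -> : (n.+1%:R / 2)%:E = ((n%:R / 2)%:E + (2^-1 : R)%:E)%E.
  by rewrite -EFinD -natr1 mulrDl mul1r.
apply: leeD; first exact: ih.
apply: (@le_trans _ _ (\int[leb]_(t in `[(r / 2)%R, r[) (cst (r^-1)%:E) t)%E).
  rewrite integral_cst//= lebesgue_measure_itv/= lte_fin rr -EFinB -EFinM lee_fin.
  rewrite le_eqVlt; apply/orP; left; apply/eqP; field.
  by rewrite gt_eqF.
apply: le_ge0_integral => t /=; first by rewrite lee_fin invr_ge0 ltW.
rewrite in_itv/= lee_fin => /andP[rt tr]; have t0 : 0 < t by lra.
by rewrite invE// lef_pV2// ltW.
Qed.

(** The modulus of continuity is monotone; if it stayed above eps near 0, its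
    quotient by t would dominate eps / t, which has infinite integral. *)
Lemma dini_uniform {K : pmetricType R} (D : set K) (g : K -> R) (eps : R) :
  dini_continuous D g -> 0 < eps -> exists2 t, 0 < t &
    forall x y, D x -> D y -> mdist x y <= t -> `|g x - g y| <= eps.
Proof.
move=> [c c0 int_fin] eps0; apply: contrapT => no_t.
have mod_ge t : 0 < t -> (eps%:E <= modulus D g t)%E.
  move=> t0; apply: contrapT => /negP; rewrite -ltNge => mod_lt; apply: no_t.
  exists t => // x y Dx Dy xy; rewrite -lee_fin; apply: le_trans (ltW mod_lt).
  by apply: ereal_sup_ubound; exists x, y.
have J_le n : ((eps * (n%:R / 2))%:E <=
    \int[leb]_(t in `]0%R, c[) (modulus D g t * (t^-1)%:E))%E.
  apply: (@le_trans _ _ (\int[leb]_(t in `]0%R, c[) (eps%:E * (inv t)%:E))%E).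
    rewrite ge0_integralZl_EFin ?(ltW eps0)//.
    - by rewrite EFinM lee_pmul2l//; exact: integral_inv_unbounded.
    - by move=> t _; rewrite lee_fin expR_ge0.
    - apply/measurable_EFinP; apply: (@measurable_funS _ _ _ _ setT) => //.
      apply: measurableT_comp; first exact: measurable_expR.
      by apply: measurableT_comp => //; exact: measurable_ln.
  apply: le_ge0_integral => t /=.
    by rewrite -EFinM lee_fin mulr_ge0 ?expR_ge0 ?(ltW eps0).
  rewrite in_itv/= => /andP[t0 _]; rewrite invE//.
  by apply: lee_wpmul2r; [rewrite lee_fin invr_ge0 ltW|exact: mod_ge].
move: int_fin J_le; case: (\int[leb]_(t in _) _)%E => [J| |] //= _; last first.
  by move/(_ 0%N); rewrite leeNy_eq.
move=> J_le; have [n nJ] : exists n : nat, J < eps * (n%:R / 2).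
  exists (Num.truncn (J / (eps / 2))).+1; rewrite mulrCA.
  by rewrite -ltr_pdivrMr ?divr_gt0// truncnS_gt.
by have := J_le n; rewrite lee_fin leNgt nJ.
Qed.

End Dini.

(** * Integrals along random words *)

Section MarkovIntegrals.
Context {R : realType} {K : pmetricType R} {N : nat} {E : pfinType}.
Variables (Ms : markovSystem K N E) (a : R) (mu : probability (borel K) R).
Hypotheses (a_gt0 : 0 < a) (a_lt1 : a < 1) (Ms_contractive : contractive Ms a).
Hypothesis mu_invariant : invariant_measure Ms mu.
Variable x0 : 'I_N -> K.
Hypothesis x0_cell : forall i, cell Ms i (x0 i).
Implicit Types (w : seq E) (g f : borel K -> R) (e : E).

Lemma word_map_measurable w :
  measurable_fun [set: borel K] (word_map Ms w : borel K -> borel K).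
Proof.
elim: w => [|e w ih] /=; first exact: measurable_id.
exact: (measurableT_comp ih (edge_map_measurable Ms e)).
Qed.

Lemma bounded_measurable_word_map w g :
  bounded_measurable g -> bounded_measurable (fun x : borel K => g (word_map Ms w x)).
Proof.
move=> [mg [B gB]]; split; last by exists B.
exact: measurableT_comp mg (word_map_measurable w).
Qed.

Lemma bounded_measurable_edge_prob e :
  bounded_measurable (edge_prob Ms e : borel K -> R).
Proof.
split; first exact: edge_prob_measurable.
by exists 1 => x; rewrite ger0_norm ?edge_prob_ge0// edge_prob_le1.
Qed.

Lemma bounded_measurable_path_prob w :
  bounded_measurable (path_prob Ms w : borel K -> R).
Proof.
split; last by exists 1 => x; rewrite ger0_norm ?path_prob_ge0// path_prob_le1.
elim: w => [|e w ih] /=; first exact: measurable_cst.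
apply: measurable_funM; first exact: edge_prob_measurable.
exact: measurableT_comp ih (edge_map_measurable Ms e).
Qed.

Lemma bounded_measurable_iter n g : bounded_measurable g ->
  bounded_measurable (iter n (markov_op Ms) g : borel K -> R).
Proof.
move=> bg; rewrite (_ : iter n _ _ = fun x =>
    \sum_(w : n.-tuple E) path_prob Ms w x * g (word_map Ms w x)).
  apply: bounded_measurable_sum => w.
  apply: bounded_measurableM (bounded_measurable_path_prob w) _.
  exact: bounded_measurable_word_map.
by apply/funext => x; rewrite iter_markov_opE.
Qed.

Lemma Rintegral_iter n g : bounded_measurable g ->
  \int[mu]_x iter n (markov_op Ms) g x = \int[mu]_x g x.
Proof.
move=> bg; elim: n => //= n ih; rewrite -ih; congr fine.
by have [mf Bf] := bounded_measurable_iter n bg; exact: mu_invariant.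
Qed.

Definition word_prob w : R := \int[mu]_x path_prob Ms w x.

Lemma word_prob_ge0 w : 0 <= word_prob w.
Proof. by apply: Rintegral_ge0 => x _; exact: path_prob_ge0. Qed.

Lemma sum_word_prob n : \sum_(w : n.-tuple E) word_prob w = 1.
Proof.
rewrite -Rintegral_sum; last by move=> w; exact: bounded_measurable_path_prob.
under eq_Rintegral do rewrite sum_path_prob.
exact: Rintegral_prob_cst.
Qed.

Lemma word_prob_rconsE w e : word_prob (rcons w e) =
  \int[mu]_x (path_prob Ms w x * edge_prob Ms e (word_map Ms w x)).
Proof. by apply: eq_Rintegral => x _; rewrite path_prob_rcons. Qed.

Let bm_path_edge w e : bounded_measurable (fun x : borel K =>
  path_prob Ms w x * edge_prob Ms e (word_map Ms w x)).
Proof.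
apply: bounded_measurableM (bounded_measurable_path_prob w) _.
exact: bounded_measurable_word_map (bounded_measurable_edge_prob e).
Qed.

Lemma sum_word_prob_rcons w : \sum_e word_prob (rcons w e) = word_prob w.
Proof.
under eq_bigr do rewrite word_prob_rconsE.
rewrite -Rintegral_sum; last by move=> e; exact: bm_path_edge.
apply: eq_Rintegral => x _.
by rewrite -mulr_sumr edge_prob_sum1 mulr1.
Qed.

Definition word_base w : K := x0 (ini Ms (head point w)).

(** The error, averaged over words starting at x, of replacing x by the base
    point of its cell. *)
Definition discrepancy n g (x : borel K) : R := \sum_(w : n.+1.-tuple E)
  path_prob Ms w x * `|g (word_map Ms w x) - g (word_map Ms w (word_base w))|.

Lemma discrepancy_ge0 n g x : 0 <= discrepancy n g x.
Proof. by apply: sumr_ge0 => w _; rewrite mulr_ge0// path_prob_ge0. Qed.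

Let bm_discrepancy_term w g : bounded_measurable g ->
  bounded_measurable (fun x : borel K => path_prob Ms w x *
    `|g (word_map Ms w x) - g (word_map Ms w (word_base w))|).
Proof.
move=> bg; apply: bounded_measurableM (bounded_measurable_path_prob w) _.
apply: bounded_measurable_norm; apply: bounded_measurableB.
  exact: bounded_measurable_word_map.
exact: bounded_measurable_cst.
Qed.

Lemma bounded_measurable_discrepancy n g :
  bounded_measurable g -> bounded_measurable (discrepancy n g).
Proof. by move=> bg; apply: bounded_measurable_sum => w; exact: bm_discrepancy_term. Qed.

(** Words of nonzero weight start at an edge leaving the cell of x, so their
    base point is the base point of that cell. *)
Lemma discrepancy_base n g i x : cell Ms i x -> discrepancy n g x =
  \sum_(w : n.+1.-tuple E)
     path_prob Ms w x * `|g (word_map Ms w x) - g (word_map Ms w (x0 i))|.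
Proof.
move=> ix; apply: eq_bigr => w _.
case: w => -[//|e w] sw /=; have [->|pe] := eqVneq (edge_prob Ms e x) 0.
  by rewrite !mul0r.
by rewrite /word_base /= (cell_uniq ix (cell_ini pe)).
Qed.

Lemma discrepancy_cvg0 g x : cellwise_uniform Ms g ->
  discrepancy n g x @[n --> \oo] --> 0.
Proof.
move=> ug; have [i ix] := cell_exists Ms x; apply/cvgrPdist_le => eps eps0.
have eps2 : 0 < eps / 2 by rewrite divr_gt0.
have [C C0 gC] := cellwise_uniform_sum Ms_contractive (ltW a_gt0) ug eps2.
have a1 : `|a| < 1 by rewrite gtr0_norm.
have geo := cvg_geometric (C * mdist x (x0 i) * a) a1.
near=> n.
rewrite sub0r normrN ger0_norm ?discrepancy_ge0// (discrepancy_base _ _ ix).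
apply: le_trans (gC n.+1 i x (x0 i) ix (x0_cell i)) _.
rewrite [leRHS]splitr lerD2l.
have -> : C * (a ^+ n.+1 * mdist x (x0 i)) = geometric (C * mdist x (x0 i) * a) a n.
  by rewrite /geometric/= exprS; ring.
by near: n; exact: (cvgr_le _ geo).
Unshelve. all: by end_near. Qed.

Lemma Rintegral_discrepancy_cvg0 g : bounded_measurable g -> cellwise_uniform Ms g ->
  \int[mu]_x discrepancy n g x @[n --> \oo] --> 0.
Proof.
move=> bg ug; have -> : 0 = \int[mu]_(x in [set: borel K]) 0 :> R.
  by rewrite Rintegral_prob_cst.
have [mg [B gB]] := bg.
apply: (cvg_Rintegral (B := 2 * B)) => //.
- by move=> n; have [] := bounded_measurable_discrepancy n bg.
- move=> n x; rewrite ger0_norm ?discrepancy_ge0//.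
  apply: (@le_trans _ _ (\sum_(w : n.+1.-tuple E) path_prob Ms w x * (2 * B))).
    apply: ler_sum => w _; rewrite ler_wpM2l ?path_prob_ge0//.
    by apply: le_trans (ler_normB _ _) _; rewrite mulr_natl mulr2n lerD.
  by rewrite -mulr_suml sum_path_prob mul1r.
- by apply: aeW => x; exact: discrepancy_cvg0.
Qed.

Lemma sum_word_prob_base n g : bounded_measurable g ->
  `|\sum_(w : n.+1.-tuple E) word_prob w * g (word_map Ms w (word_base w)) -
    \int[mu]_x g x| <= \int[mu]_x discrepancy n g x.
Proof.
move=> bg; rewrite distrC; pose D w x := path_prob Ms w x *
  (g (word_map Ms w x) - g (word_map Ms w (word_base w))).
have bD w : bounded_measurable (D w : borel K -> R).
  apply: bounded_measurableM (bounded_measurable_path_prob w) _.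
  apply: bounded_measurableB (bounded_measurable_word_map w bg) _.
  exact: bounded_measurable_cst.
have -> : \int[mu]_x g x - \sum_(w : n.+1.-tuple E)
      word_prob w * g (word_map Ms w (word_base w)) =
    \int[mu]_x \sum_(w : n.+1.-tuple E) D w x.
  have -> : \int[mu]_x g x = \int[mu]_x \sum_(w : n.+1.-tuple E)
      path_prob Ms w x * g (word_map Ms w x).
    rewrite -(Rintegral_iter n.+1 bg); apply: eq_Rintegral => x _.
    by rewrite iter_markov_opE.
  rewrite [RHS]Rintegral_sum// Rintegral_sum; last first.
    move=> w; apply: bounded_measurableM (bounded_measurable_path_prob w) _.
    exact: bounded_measurable_word_map.
  rewrite -sumrB; apply: eq_bigr => w _; rewrite /D.
  under [in RHS]eq_Rintegral do rewrite mulrBr.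
  rewrite RintegralB//; last 2 first.
  - apply: bounded_measurable_integrable.
    apply: bounded_measurableM (bounded_measurable_path_prob w) _.
    exact: bounded_measurable_word_map.
  - apply: bounded_measurable_integrable.
    apply: bounded_measurableM (bounded_measurable_path_prob w) _.
    exact: bounded_measurable_cst.
  rewrite RintegralZr//; apply: bounded_measurable_integrable.
  exact: bounded_measurable_path_prob.
have bsD : bounded_measurable (fun x : borel K => \sum_(w : n.+1.-tuple E) D w x).
  exact: bounded_measurable_sum.
apply: le_trans (le_normr_Rintegral measurableT (bounded_measurable_integrable mu bsD)) _.
apply: le_Rintegral => //.
- by apply: bounded_measurable_integrable; exact: bounded_measurable_norm.
- by apply: bounded_measurable_integrable; exact: bounded_measurable_discrepancy.
move=> x _; apply: le_trans (ler_norm_sum _ _ _) _; apply: ler_sum => w _.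
by rewrite normrM ger0_norm ?path_prob_ge0.
Qed.

Lemma cvg_sum_word_prob_base g : bounded_measurable g -> cellwise_uniform Ms g ->
  \sum_(w : n.+1.-tuple E) word_prob w * g (word_map Ms w (word_base w))
    @[n --> \oo] --> \int[mu]_x g x.
Proof.
move=> bg ug; apply/cvgrPdist_le => eps eps0.
have := Rintegral_discrepancy_cvg0 bg ug; move/cvgr_le/(_ _ eps0).
apply: filterS => n dn; rewrite distrC.
exact: le_trans (sum_word_prob_base n bg) dn.
Qed.

(** The left side compares the law of the next letter given the word w with the
    edge probabilities at the image of the base point. *)
Lemma sum_dist_word_prob_rcons n e :
  \sum_(w : n.+1.-tuple E) `|word_prob (rcons w e) -
      word_prob w * edge_prob Ms e (word_map Ms w (word_base w))| <=
    \int[mu]_x discrepancy n (edge_prob Ms e) x.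
Proof.
have be := bounded_measurable_edge_prob e.
rewrite Rintegral_sum; last by move=> w; exact: bm_discrepancy_term.
apply: ler_sum => w _; rewrite word_prob_rconsE.
rewrite -RintegralZr//; last first.
  by apply: bounded_measurable_integrable; exact: bounded_measurable_path_prob.
have bpc (c : R) : bounded_measurable (fun x : borel K => path_prob Ms w x * c).
  apply: bounded_measurableM (bounded_measurable_path_prob w) _.
  exact: bounded_measurable_cst.
rewrite -RintegralB//; try exact: bounded_measurable_integrable.
apply: le_trans (le_normr_Rintegral measurableT _) _.
  by apply: bounded_measurable_integrable; exact: bounded_measurableB.
rewrite le_eqVlt; apply/orP; left; apply/eqP; apply: eq_Rintegral => x _.
by rewrite -mulrBr normrM ger0_norm ?path_prob_ge0.
Qed.

End MarkovIntegrals.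

(** * The entropy rate of the Markov measure *)

Section CellwiseUniform.
Context {R : realType} {K : pmetricType R} {N : nat} {E : finType}.
Variable Ms : markovSystem K N E.
Implicit Types (g f : K -> R) (e : E).

Lemma cellwise_uniform_cst (c : R) : cellwise_uniform Ms (fun=> c).
Proof.
by move=> eps eps0; exists 0 => // i x y _ _; rewrite subrr normr0 mul0r addr0 ltW.
Qed.

Lemma cellwise_uniformD f g : cellwise_uniform Ms f -> cellwise_uniform Ms g ->
  cellwise_uniform Ms (fun x => f x + g x).
Proof.
move=> uf ug eps eps0; have eps2 : 0 < eps / 2 by rewrite divr_gt0.
have [C C0 fC] := uf _ eps2; have [D D0 gD] := ug _ eps2.
exists (C + D) => [|i x y ix iy]; first exact: addr_ge0.
have := fC i x y ix iy; have := gD i x y ix iy.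
by rewrite !ler_norml mulrDl => /andP[? ?] /andP[? ?]; apply/andP; split; lra.
Qed.

Lemma cellwise_uniform_bigsum (I : Type) (r : seq I) (g : I -> K -> R) :
  (forall i, cellwise_uniform Ms (g i)) ->
  cellwise_uniform Ms (fun x => \sum_(i <- r) g i x).
Proof.
move=> ug; elim: r => [|i r ih].
  by under eq_fun do rewrite big_nil; exact: cellwise_uniform_cst.
by under eq_fun do rewrite big_cons; exact: cellwise_uniformD.
Qed.

Lemma cellwise_uniform_xlnx g : (forall x, 0 <= g x <= 1) ->
  cellwise_uniform Ms g -> cellwise_uniform Ms (fun x => xlnx (g x)).
Proof.
move=> g01 ug eps eps0; have eps2 : 0 < eps / 2 by rewrite divr_gt0.
have [C C0 xC] := xlnx_almost_lipschitz eps2.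
have C1 : 0 < C + 1 by rewrite ltr_wpDl.
have [D D0 gD] := ug _ (divr_gt0 eps2 C1).
exists (C * D) => [|i x y ix iy]; first exact: mulr_ge0.
apply: le_trans (xC _ _ (g01 x) (g01 y)) _.
have : C * `|g x - g y| <= C * (eps / 2 / (C + 1) + D * mdist x y).
  by rewrite ler_wpM2l//; exact: gD ix iy.
have : C * (eps / 2 / (C + 1)) <= eps / 2.
  rewrite mulrA ler_pdivrMr// mulrC ler_wpM2l ?(ltW eps2)//.
  by rewrite lerDl.
rewrite mulrDr [C * (D * _)]mulrA; lra.
Qed.

(** On cells other than the one where e starts the function vanishes; beyond
    the distance t given by dini_uniform the bound 1 <= d / t on the
    oscillation suffices. *)
Lemma dini_cellwise_uniform e :
  dini_continuous (cell Ms (ini Ms e)) (edge_prob Ms e) ->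
  cellwise_uniform Ms (edge_prob Ms e).
Proof.
move=> dini eps eps0; have [t t0 pt] := dini_uniform dini eps0.
exists t^-1 => [|i x y ix iy]; first by rewrite invr_ge0 ltW.
have [ie|ine] := eqVneq i (ini Ms e).
  subst i; have [xy|xy] := leP (mdist x y) t.
    apply: le_trans (pt _ _ ix iy xy) _.
    by rewrite lerDl mulr_ge0 ?mdist_ge0// invr_ge0 ltW.
  apply: (@le_trans _ _ 1).
    have := edge_prob_ge0 Ms e x; have := edge_prob_ge0 Ms e y.
    have := edge_prob_le1 Ms e x; have := edge_prob_le1 Ms e y.
    by move=> ? ? ? ?; rewrite ler_norml; apply/andP; split; lra.
  rewrite -[leLHS]add0r lerD ?(ltW eps0)// mulrC ler_pdivlMr// mul1r.
  exact: ltW.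
have out z : cell Ms i z -> edge_prob Ms e z = 0.
  by move=> iz; apply: edge_prob_out => ez; move: ine; rewrite (cell_uniq iz ez) eqxx.
rewrite !out// subrr normr0 addr_ge0 ?(ltW eps0)// mulr_ge0 ?mdist_ge0//.
by rewrite invr_ge0 ltW.
Qed.

Lemma cellwise_uniform_continuous g : (forall i, open (cell Ms i)) ->
  cellwise_uniform Ms g -> continuous g.
Proof.
move=> ocell ug x; apply/cvgrPdist_le => eps eps0.
have eps2 : 0 < eps / 2 by rewrite divr_gt0.
have [C C0 gC] := ug _ eps2; have [i ix] := cell_exists Ms x.
have C1 : 0 < C + 1 by rewrite ltr_wpDl.
have ci : nbhs x (cell Ms i) by apply: open_nbhs_nbhs.
have bx : nbhs x (ball x (eps / 2 / (C + 1))) by apply: nbhsx_ballx; rewrite divr_gt0.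
near=> y; have iy : cell Ms i y by near: y.
have yb : ball x (eps / 2 / (C + 1)) y by near: y.
rewrite ballEmdist /= in yb.
apply: le_trans (gC i x y ix iy) _; rewrite [leRHS]splitr lerD2l.
apply: (@le_trans _ _ ((C + 1) * mdist x y)).
  by rewrite ler_wpM2r ?mdist_ge0// lerDl.
by rewrite mulrC -ler_pdivlMr// ltW.
Unshelve. all: by end_near. Qed.

End CellwiseUniform.

Section MarkovEntropy.
Context {R : realType} {K : pmetricType R} {N : nat} {E : pfinType}.
Variables (Ms : markovSystem K N E) (a : R) (mu : probability (borel K) R).
Hypotheses (a_gt0 : 0 < a) (a_lt1 : a < 1) (Ms_contractive : contractive Ms a).
Hypothesis mu_invariant : invariant_measure Ms mu.
Variable x0 : 'I_N -> K.
Hypothesis x0_cell : forall i, cell Ms i (x0 i).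
Variable M : probability (shift_space E) R.
Hypothesis M_markov : is_markov_measure Ms mu M.
Hypothesis prob_uniform : forall e, cellwise_uniform Ms (edge_prob Ms e).
Implicit Types (w : seq E) (e : E).

Local Notation word_prob := (word_prob Ms mu).
Local Notation word_base := (word_base Ms x0).

Lemma markov_measure_stationary : stationary M.
Proof. by move=> m m' L w; rewrite !M_markov. Qed.

Lemma law_word_atE m L (w : L.-tuple E) : law M (word_at m L) w = word_prob w.
Proof. by rewrite /law -cylinderE M_markov. Qed.

Lemma block_entropyE L :
  block_entropy M L = - \sum_(w : L.-tuple E) xlnx (word_prob w).
Proof. by congr (- _); apply: eq_bigr => w _; rewrite law_word_atE. Qed.

Lemma word_prob_rcons_le w e : word_prob (rcons w e) <= word_prob w.
Proof.
rewrite -(sum_word_prob_rcons Ms mu w) (bigD1 e)//= lerDl sumr_ge0// => *.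
exact: word_prob_ge0.
Qed.

(** Chain rule: the entropy of one more letter is the average over w of the
    entropy of the conditional law of the next letter. *)
Lemma block_entropy_increment n :
  block_entropy M n.+1 - block_entropy M n = - \sum_(w : n.-tuple E)
    word_prob w * \sum_e xlnx (word_prob (rcons w e) / word_prob w).
Proof.
rewrite !block_entropyE (sum_tuple_rcons _ (fun w => xlnx (word_prob w))).
rewrite -opprD -sumrB; congr (- _); apply: eq_bigr => w _.
have [w0|wn0] := eqVneq (word_prob w) 0.
  rewrite w0 xlnx0 subr0 mul0r big1// => e _.
  have -> : word_prob (rcons w e) = 0; last exact: xlnx0.
  apply: le_anti; rewrite word_prob_ge0 andbT -w0; exact: word_prob_rcons_le.
have w0 : 0 < word_prob w by rewrite lt_neqAle eq_sym wn0 word_prob_ge0.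
have -> : xlnx (word_prob w) = \sum_e word_prob (rcons w e) * ln (word_prob w).
  by rewrite -mulr_suml sum_word_prob_rcons.
rewrite -sumrB mulr_sumr; apply: eq_bigr => e _.
have [->|en0] := eqVneq (word_prob (rcons w e)) 0.
  by rewrite !mul0r !xlnx0 subr0 mulr0.
have e0 : 0 < word_prob (rcons w e) by rewrite lt_neqAle eq_sym en0 word_prob_ge0.
by rewrite /xlnx ln_div ?posrE// mulrA [word_prob w * _]mulrC divfK// mulrBr.
Qed.

Definition edge_xlnx (x : K) : R := \sum_e xlnx (edge_prob Ms e x).

Let edge_prob01 e x : 0 <= edge_prob Ms e x <= 1.
Proof. by rewrite edge_prob_ge0 edge_prob_le1. Qed.

Lemma bounded_measurable_xlnx e :
  bounded_measurable ((fun x => xlnx (edge_prob Ms e x)) : borel K -> R).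
Proof.
split.
  apply: measurable_funM; first exact: edge_prob_measurable.
  exact: measurableT_comp (@measurable_ln R) (edge_prob_measurable Ms e).
have [C C0 xC] := xlnx_almost_lipschitz (@ltr01 R).
exists (1 + C) => x; have := xC (edge_prob Ms e x) 0 (edge_prob01 e x).
rewrite lexx ler01 xlnx0 !subr0 => /(_ isT)/le_trans; apply.
rewrite lerD2l -[leRHS]mulr1 ler_wpM2l// ger0_norm ?edge_prob_ge0//.
exact: edge_prob_le1.
Qed.

Lemma bounded_measurable_edge_xlnx :
  bounded_measurable (edge_xlnx : borel K -> R).
Proof. by apply: bounded_measurable_sum => e; exact: bounded_measurable_xlnx. Qed.

Lemma edge_xlnx_uniform : cellwise_uniform Ms edge_xlnx.
Proof.
by apply: cellwise_uniform_bigsum => e; apply: cellwise_uniform_xlnx.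
Qed.

Lemma block_entropy_increment_cvg :
  block_entropy M n.+2 - block_entropy M n.+1 @[n --> \oo] -->
    - \int[mu]_x edge_xlnx x.
Proof.
(* Up to sign, S n is the increment of the entropy with the law of the next
   letter given w replaced by the edge probabilities at the image of the base
   point; D n bounds the error, up to a constant. *)
pose S n := \sum_(w : n.+1.-tuple E)
  word_prob w * edge_xlnx (word_map Ms w (word_base w)).
have cS : S n @[n --> \oo] --> \int[mu]_x edge_xlnx x.
  by apply: (cvg_sum_word_prob_base a_gt0 a_lt1 Ms_contractive mu_invariant x0_cell);
    [exact: bounded_measurable_edge_xlnx|exact: edge_xlnx_uniform].
pose D n := \sum_e \int[mu]_x discrepancy Ms x0 n (edge_prob Ms e) x.
have cD : D n @[n --> \oo] --> 0.
  rewrite -[X in _ --> X](@big1_eq _ 0 +%R E (index_enum E) xpredT).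
  apply: cvg_big => [|e _]; first exact: add_continuous.
  apply: (Rintegral_discrepancy_cvg0 _ a_gt0 a_lt1 Ms_contractive x0_cell) => //.
  exact: bounded_measurable_edge_prob.
suff cdiff : (block_entropy M n.+2 - block_entropy M n.+1) + S n @[n --> \oo] --> 0.
  have -> : (fun n => block_entropy M n.+2 - block_entropy M n.+1) =
      (fun n => (block_entropy M n.+2 - block_entropy M n.+1 + S n) - S n).
    by apply/funext => n; rewrite addrK.
  by rewrite -[X in _ --> X]sub0r; exact: cvgB cdiff cS.
apply/cvgrPdist_le => eps eps0; have k0 : 0 < #|E|%:R + 1 :> R by rewrite ltr_wpDl.
have eps1 : 0 < eps / 2 / (#|E|%:R + 1) by rewrite !divr_gt0.
have [C C0 xC] := xlnx_almost_lipschitz eps1.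
have C1 : 0 < C + 1 by rewrite ltr_wpDl.
have epsC : 0 < eps / 2 / (C + 1) by rewrite !divr_gt0.
apply: filterS (cvgr_le _ cD _ epsC) => n Dn.
rewrite sub0r normrN block_entropy_increment addrC -sumrB.
apply: (@le_trans _ _ (\sum_(w : n.+1.-tuple E) \sum_e
    (word_prob w * (eps / 2 / (#|E|%:R + 1)) + C * `|word_prob (rcons w e) -
      word_prob w * edge_prob Ms e (word_map Ms w (word_base w))|))).
  apply: le_trans (ler_norm_sum _ _ _) _; apply: ler_sum => w _.
  rewrite -mulrBr -sumrB mulr_sumr.
  apply: le_trans (ler_norm_sum _ _ _) _; apply: ler_sum => e _.
  rewrite normrM (ger0_norm (word_prob_ge0 _ _ _)).
  have [w0|wn0] := eqVneq (word_prob w) 0.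
    by rewrite w0 !mul0r subr0 add0r mulr_ge0.
  have w0 : 0 < word_prob w by rewrite lt_neqAle eq_sym wn0 word_prob_ge0.
  have r01 : 0 <= word_prob (rcons w e) / word_prob w <= 1.
    rewrite divr_ge0 ?word_prob_ge0//= ler_pdivrMr// mul1r.
    exact: word_prob_rcons_le.
  apply: (@le_trans _ _ (word_prob w * (eps / 2 / (#|E|%:R + 1) +
     C * `|word_prob (rcons w e) / word_prob w -
           edge_prob Ms e (word_map Ms w (word_base w))|))).
    by rewrite ler_wpM2l ?word_prob_ge0// distrC; apply: xC.
  rewrite mulrDr lerD2l mulrCA ler_wpM2l//.
  rewrite -{1}(gtr0_norm w0) -normrM mulrBr [X in X - _]mulrC divfK//.
rewrite exchange_big/= (eq_bigr (fun e => eps / 2 / (#|E|%:R + 1) +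
  C * \sum_(w : n.+1.-tuple E) `|word_prob (rcons w e) -
           word_prob w * edge_prob Ms e (word_map Ms w (word_base w))|)); last first.
  by move=> e _; rewrite big_split/= -mulr_suml sum_word_prob mul1r mulr_sumr.
rewrite big_split/= sumr_const -mulr_sumr [leRHS]splitr lerD//.
  rewrite -[leLHS]mulr_natl mulrA ler_pdivrMr// mulrC ler_wpM2l ?lerDl//.
  by rewrite divr_ge0// ltW.
apply: (@le_trans _ _ (C * D n)).
  by rewrite ler_wpM2l//; apply: ler_sum => e _; exact: sum_dist_word_prob_rcons.
apply: (@le_trans _ _ ((C + 1) * (eps / 2 / (C + 1)))).
  apply: (@le_trans _ _ (C * (eps / 2 / (C + 1)))); first by rewrite ler_wpM2l.
  by rewrite ler_wpM2r ?lerDl// !divr_ge0// ltW.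
by rewrite mulrC divfK// gt_eqF.
Qed.

Lemma block_entropy_rate :
  block_entropy M n.+1 / n.+1%:R @[n --> \oo] --> - \int[mu]_x edge_xlnx x.
Proof.
pose u n := block_entropy M n.+1 - block_entropy M n.
have cu : u n @[n --> \oo] --> - \int[mu]_x edge_xlnx x.
  rewrite -cvg_shiftS; exact: block_entropy_increment_cvg.
have H0 : block_entropy M 0 = 0.
  rewrite block_entropyE (sum_tuple0 (fun w => xlnx (word_prob w))).
  rewrite (_ : word_prob [::] = 1) ?xlnx1 ?oppr0//.
  by rewrite -(sum_word_prob Ms mu 0) (sum_tuple0 word_prob).
have -> : (fun n => block_entropy M n.+1 / n.+1%:R) = arithmetic_mean u.
  apply/funext => n; rewrite /arithmetic_mean/= mulrC seriesEnat/=; congr (_ * _).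
  by rewrite telescope_sumr// H0 subr0.
exact: cesaro cu.
Qed.

End MarkovEntropy.

(** * The coding map and the entropy formula *)

Section Coding.
Context {R : realType} {K : pmetricType R} {N : nat} {E : pfinType}.
Variables (Ms : markovSystem K N E) (a : R) (mu : probability (borel K) R).
Hypotheses (a_gt0 : 0 < a) (a_lt1 : a < 1) (Ms_contractive : contractive Ms a).
Hypothesis mu_invariant : invariant_measure Ms mu.
Hypothesis cell_open : forall i, open (cell Ms i).
Variable x0 : 'I_N -> K.
Hypothesis x0_cell : forall i, cell Ms i (x0 i).
Variable M : probability (shift_space E) R.
Hypothesis M_markov : is_markov_measure Ms mu M.
Variable F : {mfun shift_space E >-> borel K}.
Hypothesis F_coding : is_coding_map Ms M x0 F.

Lemma rev_word_at (s : shift_space E) n :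
  rev (word_at (- n%:Z) n.+1 s) = [seq s (- j%:Z) | j <- iota 0 n.+1].
Proof.
apply: (@eq_from_nth _ point) => [|j].
  by rewrite size_rev size_tuple size_map size_iota.
rewrite size_rev size_tuple => jn; rewrite nth_rev ?size_tuple//.
rewrite (nth_map 0%N) ?size_iota// nth_iota// add0n subSS.
have nj : (n - j < n.+1)%N by lia.
rewrite -[X in nth _ _ X]/(nat_of_ord (Ordinal nj)) -tnth_nth tnth_mktuple/=.
by congr (s _); lia.
Qed.

Lemma coding_approxE (s : shift_space E) n : coding_approx Ms x0 s n =
  word_map Ms (word_at (- n%:Z) n.+1 s) (word_base Ms x0 (word_at (- n%:Z) n.+1 s)).
Proof.
rewrite /coding_approx /word_map /word_base -[X in foldl _ _ X]revK foldl_rev.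
rewrite rev_word_at foldr_map.
(* The approximation applies the oldest letter first, and that letter starts
   the word. *)
congr (foldr _ _ _); congr (x0 (ini Ms _)).
by rewrite -nth0 -[0%N]/(nat_of_ord (@ord0 n)) -tnth_nth tnth_mktuple/= addr0.
Qed.

(** Both sides are the limit of the integrals over M of g at the approximations
    of F, by continuity of g on one side and by cvg_sum_word_prob_base on the
    other. *)
Lemma Rintegral_coding (g : borel K -> R) : bounded_measurable g ->
  cellwise_uniform Ms g -> \int[M]_s g (F s) = \int[mu]_x g x.
Proof.
move=> bg ug; have cg := cellwise_uniform_continuous cell_open ug.
pose phi n (w : n.+1.-tuple E) := g (word_map Ms w (word_base Ms x0 w)).
pose Z n : shift_space E -> n.+1.-tuple E := word_at (- n%:Z) n.+1.
have mZ n : finite_rv (Z n) by exact: word_at_finite_rv.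
have [mg [B gB]] := bg.
have cvg1 : \int[M]_s phi n (Z n s) @[n --> \oo] --> \int[mu]_x g x.
  have -> : (fun n => \int[M]_s phi n (Z n s)) = (fun n =>
      \sum_(w : n.+1.-tuple E) word_prob Ms mu w * phi n w).
    apply/funext => n; rewrite (Rintegral_law M (phi n) (mZ n)).
    by apply: eq_bigr => w _; rewrite (law_word_atE M_markov).
  exact: (cvg_sum_word_prob_base a_gt0 a_lt1 Ms_contractive mu_invariant x0_cell).
have cvg2 : \int[M]_s phi n (Z n s) @[n --> \oo] --> \int[M]_s g (F s).
  apply: (cvg_Rintegral (B := B)).
  - move=> n _ A _; rewrite setTI.
    exact: (finite_rv_preimage (phi n @^-1` A) (mZ n)).
  - exact: (measurableT_comp mg).
  - by move=> n s; exact: gB.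
  - apply: filterS F_coding; first exact: (ae_filter_ringOfSetsType M).
    move=> s Fs.
    have -> : (fun n => phi n (Z n s)) = (fun n => g (coding_approx Ms x0 s n)).
      by apply/funext => n; rewrite coding_approxE.
    by apply: continuous_cvg Fs; exact: cg.
exact: (cvg_unique _ cvg2 cvg1).
Qed.

Lemma integral_cell_xlnx d (T : measurableType d)
    (nu : {measure set T -> \bar R}) (f : T -> K) e :
  (\int[nu]_(t in f @^-1` cell Ms (ini Ms e)) (xlnx (edge_prob Ms e (f t)))%:E =
   \int[nu]_t (xlnx (edge_prob Ms e (f t)))%:E)%E.
Proof.
rewrite integral_mkcond; apply: eq_integral => t _; rewrite patchE.
case: ifPn => // /negP; rewrite inE => /edge_prob_out ->.
by rewrite xlnx0.
Qed.

Lemma sum_integral_xlnx :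
  (- \sum_(e : E) \int[mu]_(y in cell Ms (ini Ms e)) (xlnx (edge_prob Ms e y))%:E =
   (- \int[mu]_x edge_xlnx Ms x)%:E)%E.
Proof.
rewrite EFinN Rintegral_sum; last exact: bounded_measurable_xlnx.
rewrite -sumEFin; congr (- _)%E; apply: eq_bigr => e _.
rewrite (integral_cell_xlnx mu id) EFin_Rintegral//.
exact: bounded_measurable_xlnx.
Qed.

Hypothesis prob_uniform : forall e, cellwise_uniform Ms (edge_prob Ms e).

Lemma integral_pushforward_xlnx e :
  (\int[pushforward M F]_(y in cell Ms (ini Ms e)) (xlnx (edge_prob Ms e y))%:E =
   \int[mu]_(y in cell Ms (ini Ms e)) (xlnx (edge_prob Ms e y))%:E)%E.
Proof.
have bx := bounded_measurable_xlnx Ms e; have [mx [B xB]] := bx.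
have bxF : bounded_measurable (fun s => xlnx (edge_prob Ms e (F s))).
  by split; [exact: measurableT_comp mx _|exists B].
have mcell := cell_measurable Ms (ini Ms e).
rewrite integral_pushforward//.
- rewrite (integral_cell_xlnx M F) (integral_cell_xlnx mu id) -!EFin_Rintegral//.
  congr EFin; apply: Rintegral_coding => //; apply: cellwise_uniform_xlnx => // x.
  by rewrite edge_prob_ge0 edge_prob_le1.
- exact/measurable_EFinP.
- apply: integrableS (bounded_measurable_integrable M bxF) => //.
  by rewrite -[X in measurable X]setTI; exact: (measurable_funPT F).
Qed.

End Coding.

Theorem theorem2 (R : realType) (K : pmetricType R) (N : nat) (E : pfinType)
  (Ms : markovSystem K N E) (a : R) (mu : probability (borel K) R)
  (a_gt0 : 0 < a) (a_lt1 : a < 1) (Ms_contractive : contractive Ms a)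
  (mu_invariant : invariant_measure Ms mu)
  (K_proper : forall A : set K, (diam A < +oo)%E -> precompact A)
  (cell_open : forall i, open (cell Ms i))
  (prob_dini : forall e, dini_continuous (cell Ms (ini Ms e)) (edge_prob Ms e))
  (prob_bounded_below : exists2 delta : R, 0 < delta &
    forall e x, cell Ms (ini Ms e) x -> delta <= edge_prob Ms e x)
  (ini_surjective : forall i, exists e, ini Ms e = i)
  (M : probability (shift_space E) R) (M_markov : is_markov_measure Ms mu M)
  (x0 : 'I_N -> K) (x0_cell : forall i, cell Ms i (x0 i))
  (F : {mfun shift_space E >-> borel K}) (F_coding : is_coding_map Ms M x0 F) :
  ((exists2 x : 'I_N -> K, forall i, cell Ms i (x i) &
      (\sum_(i < N) \int[mu]_(y in cell Ms i) (mdist y (x i))%:E < +oo)%E) ->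
    (KS_entropy M (@left_shift E) =
      - \sum_(e : E) \int[pushforward M F]_(y in cell Ms (ini Ms e))
          (edge_prob Ms e y * ln (edge_prob Ms e y))%:E)%E)
  /\
  ((forall nu : probability (borel K) R, invariant_measure Ms nu ->
      forall A : set (borel K), measurable A -> nu A = mu A) ->
    (KS_entropy M (@left_shift E) =
      - \sum_(e : E) \int[mu]_(y in cell Ms (ini Ms e))
          (edge_prob Ms e y * ln (edge_prob Ms e y))%:E)%E).
Proof.
have prob_uniform e : cellwise_uniform Ms (edge_prob Ms e).
  exact: dini_cellwise_uniform.
have entropy_mu : KS_entropy M (@left_shift E) =
    (- \sum_(e : E) \int[mu]_(y in cell Ms (ini Ms e))
        (xlnx (edge_prob Ms e y))%:E)%E.
  rewrite sum_integral_xlnx; apply: shift_KS_entropy.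
    exact: markov_measure_stationary M_markov.
  exact: block_entropy_rate a_gt0 a_lt1 Ms_contractive mu_invariant _ x0_cell
    _ M_markov prob_uniform.
split=> _; last exact: entropy_mu.
rewrite entropy_mu; congr (- _)%E; apply: eq_bigr => e _; apply/esym.
exact: integral_pushforward_xlnx a_gt0 a_lt1 Ms_contractive mu_invariant
  cell_open x0 x0_cell M M_markov F F_coding prob_uniform e.
Qed.
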